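(* Let $M:\mathbb{P}^n\to\mathbb{P}$ be an $n$-variable operator mean and let $\sigma$ be a ($2$-variable) operator mean with $\sigma\neq\mathfrak{l}$. Then: (1) For every $A_1,\dots,A_n\in\mathbb{P}$ there exists a unique $X_0\in\mathbb{P}$ such that $$X_0=M(X_0\,\sigma A_1,\dots,X_0\,\sigma A_n).$$ (2) Write $M_\sigma(A_1,\dots,A_n)$ for the unique solution $X_0$ in (1). Then $M_\sigma:\mathbb{P}^n\to\mathbb{P}$ is again an $n$-variable operator mean, i.e., it satisfies (I) monotonicity, (II) congruence invariance, (III) monotone continuity and (IV) the normalized condition. (3) Let $A_1,\dots,A_n\in\mathbb{P}$. If $Y\in\mathbb{P}$ and $Y\le M(Y\sigma A_1,\dots,Y\sigma A_n)$, then $Y\le M_\sigma(A_1,\dots,A_n)$. If $Y\in\mathbb{P}$ and $Y\ge M(Y\sigma A_1,\dots,Y\sigma A_n)$, then $Y\ge M_\sigma(A_1,\dots,A_n)$.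
   Context: $\mathcal{H}$ is an infinite-dimensional Hilbert space, $B(\mathcal{H})$ the bounded linear operators on $\mathcal{H}$, $B(\mathcal{H})^+$ the positive (semidefinite) operators, $\mathbb{P}=\mathbb{P}(\mathcal{H})$ the positive invertible operators; $\le$ is the usual order on self-adjoint operators and SOT is the strong operator topology. $A_k\searrow A$ (resp. $A_k\nearrow A$) means that the sequence is decreasing (resp. increasing) and $A_k\to A$ in SOT. Operator mean (Kubo–Ando): a map $\sigma:B(\mathcal{H})^+\times B(\mathcal{H})^+\to B(\mathcal{H})^+$ such that (i) $A\le C$, $B\le D$ imply $A\sigma B\le C\sigma D$; (ii) $C(A\sigma B)C\le(CAC)\sigma(CBC)$ for all $C\in B(\mathcal{H})^+$; (iii) $A_k\searrow A$, $B_k\searrow B$ imply $A_k\sigma B_k\searrow A\sigma B$; (iv) $I\sigma I=I$. By Kubo–Ando, operator means correspond bijectively to nonnegative operator monotone functions $f_\sigma$ on $(0,\infty)$ with $f_\sigma(1)=1$ (the representing function), via $f_\sigma(x)I=I\sigma(xI)$ and $A\sigma B=A^{1/2}f_\sigma(A^{-1/2}BA^{-1/2})A^{1/2}$ for $A,B\in\mathbb{P}$. The left trivial mean $\mathfrak{l}$ is $A\,\mathfrak{l}\,B=A$. $n$-variable operator mean: a map $M:\mathbb{P}^n\to\mathbb{P}$ such that (I) (monotonicity) $A_j\le B_j$ for all $j$ implies $M(A_1,\dots,A_n)\le M(B_1,\dots,B_n)$; (II) (congruence invariance) $S^*M(A_1,\dots,A_n)S=M(S^*A_1S,\dots,S^*A_nS)$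 for every invertible $S\in B(\mathcal{H})$; (III) (monotone continuity) for $A_j,A_{jk}\in\mathbb{P}$, if either $A_{jk}\searrow A_j$ as $k\to\infty$ for each $j$, or $A_{jk}\nearrow A_j$ as $k\to\infty$ for each $j$, then $M(A_{1k},\dots,A_{nk})\to M(A_1,\dots,A_n)$ in SOT; (IV) (normalized condition) $M(I,\dots,I)=I$. *)

(* Defs.v *)
From HB Require Import structures.
From mathcomp Require Import all_boot all_order all_algebra.
From mathcomp Require Import all_classical all_reals all_analysis.
From mathcomp Require Import complex.

Set Implicit Arguments.
Unset Strict Implicit.
Unset Printing Implicit Defensive.
Import Order.TTheory GRing.Theory Num.Theory.
Import numFieldNormedType.Exports.
Local Open Scope ring_scope.
Local Open Scope complex_scope.
Local Open Scope classical_set_scope.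

(* Complex Hilbert spaces: the inner product is linear in its first argument
   and conjugate-linear in its second one. *)
HB.mixin Record CompleteNormedModule_isHilbert (R : realType) H
    of CompleteNormedModule R[i] H := {
  inner : {dot H for (@Num.conj R[i])} ;
  inner_normE : forall x : H, inner x x = `|x| ^+ 2
}.

#[short(type="hilbertType")]
HB.structure Definition Hilbert (R : realType) :=
  {H of CompleteNormedModule R[i] H & CompleteNormedModule_isHilbert R H}.

Definition infinite_dimensional (R : realType) (H : hilbertType R) : Prop :=
  ~ exists (n : nat) (v : 'I_n -> H),
      forall x : H, exists c : 'I_n -> R[i], x = \sum_(i < n) c i *: v i.

Section BoundedOperators.
Context {R : realType} {H : hilbertType R}.

Record bop := BOp {
  bop_fun :> H -> H ;
  bop_linear : linear bop_fun ;
  bop_bounded : exists c : R[i], forall x : H, `|bop_fun x| <= c * `|x|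
}.

HB.instance Definition _ (A : bop) :=
  GRing.isLinear.Build R[i] H H *:%R (bop_fun A) (bop_linear A).

Lemma bop_eqP (A B : bop) : A = B <-> forall x, A x = B x.
Proof.
split=> [->//|]; case: A B => [f fl fb] [g gl gb] /= fg.
have {}fg : f = g by apply/funext.
by subst g; congr BOp; exact: Prop_irrelevance.
Qed.

Lemma id_bounded : exists c : R[i], forall x : H, `|idfun x| <= c * `|x|.
Proof. by exists 1 => x; rewrite mul1r. Qed.

Definition bop_id : bop := BOp (linearP idfun) id_bounded.

Lemma comp_bounded (A B : bop) :
  exists c : R[i], forall x : H, `|(A \o B) x| <= c * `|x|.
Proof.
have [c cA] := bop_bounded A; have [d dB] := bop_bounded B.
exists (`|c| * d) => x /=; apply: (@le_trans _ _ (`|c| * `|B x|)).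
  have cB0 := le_trans (normr_ge0 _) (cA (B x)).
  by rewrite (le_trans (cA _))// -(ger0_norm cB0) normrM normr_id.
by rewrite -mulrA ler_wpM2l.
Qed.

Definition bop_comp (A B : bop) : bop := BOp (linearP (A \o B)) (comp_bounded A B).

Definition bop_invertible (A : bop) : Prop :=
  exists B : bop, bop_comp A B = bop_id /\ bop_comp B A = bop_id.

(* [is_adjoint S T] says that T is the adjoint of S, which exists and is unique
   by the Riesz representation theorem. *)
Definition is_adjoint (S T : bop) : Prop :=
  forall x y : H, inner (S x) y = inner x (T y).

(* In the order of R[i], 0 <= z means that z is real and nonnegative.  As H is
   a complex space, a positive operator is thus self-adjoint. *)
Definition positive_op (A : bop) : Prop :=
  forall x : H, 0 <= inner (A x) x.

(* z <= w in R[i] means 0 <= w - z, so this says that B - A is positive. *)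
Definition le_op (A B : bop) : Prop :=
  forall x : H, inner (A x) x <= inner (B x) x.

Definition posinv_op (A : bop) : Prop := positive_op A /\ bop_invertible A.

Definition sot_cvg (A : nat -> bop) (B : bop) : Prop :=
  forall x : H, A k x @[k --> \oo] --> B x.

Definition decreases_to (A : nat -> bop) (B : bop) : Prop :=
  (forall k l : nat, (k <= l)%N -> le_op (A l) (A k)) /\ sot_cvg A B.

Definition increases_to (A : nat -> bop) (B : bop) : Prop :=
  (forall k l : nat, (k <= l)%N -> le_op (A k) (A l)) /\ sot_cvg A B.

(* A map on positive (resp. positive invertible) operators is represented by a
   map on all bounded operators, whose values outside of this domain are
   irrelevant. *)
Record operator_mean (sigma : bop -> bop -> bop) : Prop := OperatorMean {
  mean_positive : forall A B, positive_op A -> positive_op B ->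
    positive_op (sigma A B) ;
  mean_monotone : forall A B C D,
    positive_op A -> positive_op B -> positive_op C -> positive_op D ->
    le_op A C -> le_op B D -> le_op (sigma A B) (sigma C D) ;
  mean_transformer : forall A B C,
    positive_op A -> positive_op B -> positive_op C ->
    le_op (bop_comp C (bop_comp (sigma A B) C))
          (sigma (bop_comp C (bop_comp A C)) (bop_comp C (bop_comp B C))) ;
  mean_continuous : forall (Ak Bk : nat -> bop) (A B : bop),
    (forall k, positive_op (Ak k)) -> (forall k, positive_op (Bk k)) ->
    positive_op A -> positive_op B ->
    decreases_to Ak A -> decreases_to Bk B ->
    decreases_to (fun k => sigma (Ak k) (Bk k)) (sigma A B) ;
  mean_normalized : sigma bop_id bop_id = bop_id
}.

Definition left_trivial (sigma : bop -> bop -> bop) : Prop :=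
  forall A B, positive_op A -> positive_op B -> sigma A B = A.

Record multi_operator_mean (n : nat) (M : ('I_n -> bop) -> bop) : Prop :=
  MultiOperatorMean {
  mmean_posinv : forall A : 'I_n -> bop,
    (forall j, posinv_op (A j)) -> posinv_op (M A) ;
  mmean_monotone : forall A B : 'I_n -> bop,
    (forall j, posinv_op (A j)) -> (forall j, posinv_op (B j)) ->
    (forall j, le_op (A j) (B j)) -> le_op (M A) (M B) ;
  mmean_congruence : forall (A : 'I_n -> bop) (S S' : bop),
    (forall j, posinv_op (A j)) -> bop_invertible S -> is_adjoint S S' ->
    bop_comp S' (bop_comp (M A) S) =
    M (fun j => bop_comp S' (bop_comp (A j) S)) ;
  mmean_continuous : forall (Ak : 'I_n -> nat -> bop) (A : 'I_n -> bop),
    (forall j k, posinv_op (Ak j k)) -> (forall j, posinv_op (A j)) ->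
    (forall j, decreases_to (Ak j) (A j)) \/
    (forall j, increases_to (Ak j) (A j)) ->
    sot_cvg (fun k => M (fun j => Ak j k)) (M A) ;
  mmean_normalized : M (fun=> bop_id) = bop_id
}.

End BoundedOperators.

Arguments bop {R} H.

(* Main.v *)
Require Import Defs.
From HB Require Import structures.
From mathcomp Require Import all_boot all_order all_algebra.
From mathcomp Require Import all_classical all_reals all_analysis.
From mathcomp Require Import complex.
From mathcomp Require Import ring lra.

(* By rank-one and spectral projections, [sigma] acts on commuting pairs through
   a representing function [f] on [0, oo), which is concave and, by monotonicity
   on a two-dimensional subspace, strictly increasing unless [sigma] is left
   trivial.  Approximating operators by finite combinations of spectral
   projections, one gets a gap [sigma I T + e <= sigma I (T + d)], hence
   [sigma X (A / c) <= b sigma X A] with [b < 1] whenever [1 < c].  So if [Y] is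
   a subsolution and [Z] a supersolution of [X = M (sigma X A_j)], then the least
   [a >= 1] with [Y <= a Z] must be 1: this comparison principle gives
   uniqueness, (3) and monotonicity, while iteration from a large multiple of
   the identity gives existence.  Continuity along increasing sequences needs
   the joint strong continuity of [sigma], which only assumes it along
   decreasing ones.  It follows, together with the invariance of [sigma] under
   arbitrary invertible congruences, from the estimate
   [|sigma A B y - f(t) A y| <= K |B y - t A y|] and from the fact that every
   vector is a sum of approximate solutions [y] of [B y = t A y]. *)

Set Implicit Arguments.
Unset Strict Implicit.
Unset Printing Implicit Defensive.
Import Order.TTheory GRing.Theory Num.Theory.
Import numFieldNormedType.Exports.
Local Open Scope ring_scope.
Local Open Scope complex_scope.
Local Open Scope classical_set_scope.

(** * Bounded operators on a Hilbert space *)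

Section RealInner.
Context {R : realType} {H : hilbertType R}.
Implicit Types (x y z : H) (c : R).

(** Two weaknesses of the axioms shape the proof: the transformer inequality is stated for positive
    [C] only, and [sigma] is continuous along decreasing sequences only. The detour through
    [f(t) A y] repairs both at once, because this vector is linear in [A]: congruence by [S] carries
    an approximate solution [y] of [B y = t A y] to [S^-1 y] with the same [t], and at a fixed [y]
    the residual passes to strong limits of [A] and [B]. The gap [e] must be the same for every [T]
    below a given bound [b], and concavity grants this: increments of [f] are smallest at the upper
    end. Spectral integrals are never formed; step operators below [T] suffice, since order
    inequalities survive the replacement and the mesh is absorbed either in half of [d] or in an
    arbitrarily small error. Infinite dimension enters as the existence of two orthonormal vectors,
    on which the scalar properties of [f] are read off. *)

Definition rip x y : R := complex.Re (inner x y).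
Definition nrm x : R := complex.Re `|x|.

Lemma nrmE x : `|x| = (nrm x)%:C.
Proof. by rewrite /nrm RRe_real// normr_real. Qed.

Lemma nrm_ge0 x : 0 <= nrm x.
Proof. by rewrite -ler0c -nrmE normr_ge0. Qed.

Lemma rip_nrm x : rip x x = nrm x ^+ 2.
Proof. by rewrite /rip inner_normE nrmE -rmorphXn. Qed.

Lemma nrm_eq0 x : (nrm x == 0) = (x == 0).
Proof. by rewrite -(normr_eq0 x) nrmE -(inj_eq (@complexI R)). Qed.

Lemma nrm0 : nrm 0 = 0.
Proof. by apply/eqP; rewrite nrm_eq0. Qed.

Lemma nrmN x : nrm (- x) = nrm x.
Proof. by rewrite /nrm normrN. Qed.

Lemma nrmD x y : nrm (x + y) <= nrm x + nrm y.
Proof. by rewrite -lecR rmorphD /= -!nrmE ler_normD. Qed.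

Lemma nrmB x y : nrm (x - y) <= nrm x + nrm y.
Proof. by rewrite -[nrm y]nrmN nrmD. Qed.

Lemma nrmZ c x : nrm (c%:C *: x) = `|c| * nrm x.
Proof.
apply: (@complexI R); rewrite rmorphM /= -!nrmE normrZ nrmE; congr (_ * _).
by rewrite normc_def /= expr0n addr0 sqrtr_sqr.
Qed.

Lemma nrm_sum (I : Type) (r : seq I) (F : I -> H) :
  nrm (\sum_(i <- r) F i) <= \sum_(i <- r) nrm (F i).
Proof.
elim/big_rec2: _ => [|i y z _ h]; first by rewrite nrm0.
by apply: le_trans (nrmD _ _) _; rewrite lerD2l.
Qed.

Lemma innerC x y : inner x y = (inner y x)^*.
Proof. by rewrite hermC expr0 mul1r. Qed.

Lemma ripC x y : rip x y = rip y x.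
Proof. by rewrite /rip innerC; case: (inner _ _). Qed.

Lemma ripDl x y z : rip (x + y) z = rip x z + rip y z.
Proof. by rewrite /rip linearDl /=; case: (inner x z); case: (inner y z). Qed.

Lemma ripZl c x y : rip (c%:C *: x) y = c * rip x y.
Proof.
rewrite /rip linearZl_LR /=; case: (inner x y) => a b /=.
by rewrite mul0r subr0.
Qed.

Lemma ripDr x y z : rip z (x + y) = rip z x + rip z y.
Proof. by rewrite ripC ripDl !(ripC z). Qed.

Lemma ripZr c x y : rip x (c%:C *: y) = c * rip x y.
Proof. by rewrite ripC ripZl ripC. Qed.

Lemma ripNl x y : rip (- x) y = - rip x y.
Proof. by rewrite -scaleN1r -(rmorphN1 (real_complex R)) ripZl mulN1r. Qed.

Lemma ripNr x y : rip x (- y) = - rip x y.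
Proof. by rewrite ripC ripNl ripC. Qed.

Lemma ripBl x y z : rip (x - y) z = rip x z - rip y z.
Proof. by rewrite ripDl ripNl. Qed.

Lemma ripBr x y z : rip z (x - y) = rip z x - rip z y.
Proof. by rewrite ripDr ripNr. Qed.

Lemma rip0l x : rip 0 x = 0.
Proof. by rewrite -(subrr 0) ripBl subrr. Qed.

Lemma rip0r x : rip x 0 = 0.
Proof. by rewrite ripC rip0l. Qed.

Definition ripE := (ripDl, ripDr, ripBl, ripBr, ripNl, ripNr, ripZl, ripZr).

Lemma rip_suml (I : Type) (r : seq I) (F : I -> H) y :
  rip (\sum_(i <- r) F i) y = \sum_(i <- r) rip (F i) y.
Proof. by elim/big_rec2: _ => [|i u v _ <-]; rewrite ?rip0l ?ripDl. Qed.

Lemma rip_sumr (I : Type) (r : seq I) (F : I -> H) y :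
  rip y (\sum_(i <- r) F i) = \sum_(i <- r) rip y (F i).
Proof. by rewrite ripC rip_suml; apply: eq_bigr => i _; rewrite ripC. Qed.

Lemma rip_xx_ge0 x : 0 <= rip x x.
Proof. by rewrite rip_nrm sqr_ge0. Qed.

Lemma rip_xx_eq0 x : rip x x = 0 -> x = 0.
Proof. by move/eqP; rewrite rip_nrm sqrf_eq0 nrm_eq0 => /eqP. Qed.

Lemma nrm_le x c : 0 <= c -> rip x x <= c ^+ 2 -> nrm x <= c.
Proof. by move=> c0; rewrite rip_nrm ler_sqr ?nnegrE ?nrm_ge0. Qed.

(** Conjugate-linearity in the second argument turns the imaginary part into a real part at
    ['i *: y], so the real form [rip] carries all of [inner]. *)
Lemma innerE x y : inner x y = rip x y +i* rip x ('i *: y).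
Proof.
rewrite /rip linearZr_LR /=; case: (inner x y) => a b /=.
by rewrite mul0r sub0r mulN1r opprK.
Qed.

Lemma rip_i x y : rip ('i *: x) ('i *: y) = rip x y.
Proof.
rewrite /rip linearZr_LR linearZl_LR /=; case: (inner x y) => a b /=.
by rewrite !(mul0r, sub0r, mul1r, add0r, addr0, mulN1r, opprK, oppr0).
Qed.

Lemma rip_iN x y : rip x ('i *: y) = - rip ('i *: x) y.
Proof.
rewrite -[X in - rip _ X]opprK ripNr opprK -(rip_i x); congr rip.
by rewrite scalerA -expr2 sqr_i scaleN1r.
Qed.

End RealInner.

(** * The real algebra of bounded operators *)

Section OperatorAlgebra.
Context {R : realType} {H : hilbertType R}.
Implicit Types (A B C : bop H) (x y : H) (c : R).

Lemma bounded_nrm (f : H -> H) c : (forall x, nrm (f x) <= c * nrm x) ->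
  exists c : R[i], forall x : H, `|f x| <= c * `|x|.
Proof.
by move=> fc; exists c%:C => x; rewrite !nrmE -rmorphM lecR.
Qed.

Lemma bop_bound A : exists2 c, 0 < c & forall x, nrm (A x) <= c * nrm x.
Proof.
have [c cA] := bop_bounded A; exists (1 + `|complex.Re c|) => [|x].
  by rewrite ltr_pwDl.
have : complex.Re `|A x| <= complex.Re (c * `|x|).
  by have := cA x; rewrite lecE => /andP[].
rewrite nrmE [complex.Re _]/= => /le_trans; apply.
rewrite nrmE; case: (c) => a b /=; rewrite mulr0 subr0.
apply: ler_wpM2r; first exact: nrm_ge0.
by rewrite (le_trans (ler_norm _))// lerDr.
Qed.

Lemma opp_linear A : linear (fun x => - A x).
Proof. by move=> a x y; rewrite linearP opprD scalerN. Qed.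

Lemma opp_bounded A : exists c : R[i], forall x : H, `|- A x| <= c * `|x|.
Proof.
have [c _ Ac] := bop_bound A.
by apply: (@bounded_nrm (fun x => - A x) c) => x; rewrite nrmN.
Qed.

Definition bop_opp A : bop H := BOp (@opp_linear A) (opp_bounded A).

Lemma add_linear A B : linear (fun x => A x + B x).
Proof. by move=> a x y; rewrite !linearP scalerDr addrACA. Qed.

Lemma add_bounded A B :
  exists c : R[i], forall x : H, `|A x + B x| <= c * `|x|.
Proof.
have [c _ Ac] := bop_bound A; have [d _ Bd] := bop_bound B.
apply: (@bounded_nrm (fun x => A x + B x) (c + d)) => x.
by rewrite (le_trans (nrmD _ _))// mulrDl lerD.
Qed.

Definition bop_add A B : bop H := BOp (@add_linear A B) (add_bounded A B).

Lemma zero_linear : linear (fun _ : H => 0 : H).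
Proof. by move=> a x y; rewrite scaler0 addr0. Qed.

Lemma zero_bounded : exists c : R[i], forall x : H, `|0 : H| <= c * `|x|.
Proof.
by apply: (@bounded_nrm (fun _ => 0) 0) => x; rewrite nrm0 mul0r.
Qed.

Definition bop_zero : bop H := BOp zero_linear zero_bounded.

Lemma scale_linear c A : linear (fun x => c%:C *: A x).
Proof.
by move=> a x y; rewrite linearP scalerDr !scalerA [c%:C * a]mulrC.
Qed.

Lemma scale_bounded c A :
  exists d : R[i], forall x : H, `|c%:C *: A x| <= d * `|x|.
Proof.
have [d _ Ad] := bop_bound A.
apply: (@bounded_nrm (fun x => c%:C *: A x) (`|c| * d)) => x.
by rewrite nrmZ -mulrA ler_wpM2l.
Qed.

Definition bop_scale c A : bop H := BOp (@scale_linear c A) (scale_bounded c A).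

HB.instance Definition _ := gen_eqMixin (bop H).
HB.instance Definition _ := gen_choiceMixin (bop H).

Fact bop_addA : associative bop_add.
Proof. by move=> A B C; apply/bop_eqP => x /=; rewrite addrA. Qed.
Fact bop_addC : commutative bop_add.
Proof. by move=> A B; apply/bop_eqP => x /=; rewrite addrC. Qed.
Fact bop_add0 : left_id bop_zero bop_add.
Proof. by move=> A; apply/bop_eqP => x /=; rewrite add0r. Qed.
Fact bop_addN : left_inverse bop_zero bop_opp bop_add.
Proof. by move=> A; apply/bop_eqP => x /=; rewrite addNr. Qed.

HB.instance Definition _ :=
  GRing.isZmodule.Build (bop H) bop_addA bop_addC bop_add0 bop_addN.

Fact bop_mulA : associative (@bop_comp R H).
Proof. by move=> A B C; apply/bop_eqP. Qed.
Fact bop_mul1 : left_id (@bop_id R H) (@bop_comp R H).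
Proof. by move=> A; apply/bop_eqP. Qed.
Fact bop_mulr1 : right_id (@bop_id R H) (@bop_comp R H).
Proof. by move=> A; apply/bop_eqP. Qed.
Fact bop_mulDl : left_distributive (@bop_comp R H) +%R.
Proof. by move=> A B C; apply/bop_eqP. Qed.
Fact bop_mulDr : right_distributive (@bop_comp R H) +%R.
Proof. by move=> A B C; apply/bop_eqP => x /=; rewrite linearD. Qed.

HB.instance Definition _ := GRing.Zmodule_isPzRing.Build (bop H)
  bop_mulA bop_mul1 bop_mulr1 bop_mulDl bop_mulDr.

Fact bop_scaleA c d A : bop_scale c (bop_scale d A) = bop_scale (c * d) A.
Proof. by apply/bop_eqP => x /=; rewrite scalerA -rmorphM. Qed.
Fact bop_scale1 : left_id 1 bop_scale.
Proof. by move=> A; apply/bop_eqP => x /=; rewrite scale1r. Qed.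
Fact bop_scaleDr : right_distributive bop_scale +%R.
Proof. by move=> c A B; apply/bop_eqP => x /=; rewrite scalerDr. Qed.
Fact bop_scaleDl A : {morph bop_scale^~ A : c d / c + d}.
Proof. by move=> c d; apply/bop_eqP => x /=; rewrite rmorphD scalerDl. Qed.

(** Scalars are real because these preserve self-adjointness, and nonnegative ones preserve the
    order. *)
HB.instance Definition _ := GRing.Zmodule_isLmodule.Build R (bop H)
  bop_scaleA bop_scale1 bop_scaleDr bop_scaleDl.

Lemma bop_addE A B x : (A + B) x = A x + B x. Proof. by []. Qed.
Lemma bop_oppE A x : (- A) x = - A x. Proof. by []. Qed.
Lemma bop_scaleE c A x : (c *: A) x = c%:C *: A x. Proof. by []. Qed.
Lemma bop_mulE A B x : (A * B) x = A (B x). Proof. by []. Qed.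
Lemma bop_oneE x : (1 : bop H) x = x. Proof. by []. Qed.
Lemma bop_zeroE x : (0 : bop H) x = 0. Proof. by []. Qed.
Definition bopE := (bop_addE, bop_oppE, bop_scaleE, bop_mulE, bop_oneE, bop_zeroE).

Lemma bop_sumE (I : Type) (r : seq I) (F : I -> bop H) x :
  (\sum_(i <- r) F i) x = \sum_(i <- r) F i x.
Proof. by elim/big_rec2: _ => // i u v _ <-. Qed.

Lemma bop_scaleAl c A B : c *: (A * B) = (c *: A) * B.
Proof. by apply/bop_eqP. Qed.
Lemma bop_scaleAr c A B : c *: (A * B) = A * (c *: B).
Proof. by apply/bop_eqP => x; rewrite !bopE linearZ. Qed.

End OperatorAlgebra.

Notation "c %:Op" := (c *: (1 : bop _))
  (at level 1, left associativity, format "c %:Op") : ring_scope.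

(** * Self-adjointness, positivity and the operator order *)

Section PositiveOperators.
Context {R : realType} {H : hilbertType R}.
Implicit Types (A B C D T : bop H) (x y : H) (c : R).

(* As [A] is complex linear, symmetry for the real form [rip] amounts to
   self-adjointness. *)
Definition sa A : Prop := forall x y, rip (A x) y = rip x (A y).

Lemma sa0 : sa 0.
Proof. by move=> x y; rewrite !bopE rip0l rip0r. Qed.

Lemma sa1 : sa 1. Proof. by []. Qed.

Lemma saD A B : sa A -> sa B -> sa (A + B).
Proof. by move=> hA hB x y; rewrite !bopE !ripE hA hB. Qed.

Lemma saN A : sa A -> sa (- A).
Proof. by move=> hA x y; rewrite !bopE !ripE hA. Qed.

Lemma saB A B : sa A -> sa B -> sa (A - B).
Proof. by move=> hA hB; apply/saD/saN. Qed.

Lemma saZ c A : sa A -> sa (c *: A).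
Proof. by move=> hA x y; rewrite !bopE !ripE hA. Qed.

Lemma sa_conj C A : sa C -> sa A -> sa (C * A * C).
Proof. by move=> hC hA x y; rewrite !bopE hC hA hC. Qed.

Lemma sa_sum (I : Type) (r : seq I) (F : I -> bop H) :
  (forall i, sa (F i)) -> sa (\sum_(i <- r) F i).
Proof.
by move=> hF; elim/big_ind: _ => // [|A B]; [exact: sa0|exact: saD].
Qed.

Lemma sa_rip_i A x : sa A -> rip (A x) ('i *: x) = 0.
Proof.
move=> saA; have : rip (A x) ('i *: x) = - rip (A x) ('i *: x).
  by rewrite [in RHS]ripC -rip_iN -(linearZ_LR A) -saA.
lra.
Qed.

Lemma positive_opP A :
  positive_op A <-> sa A /\ forall x, 0 <= rip (A x) x.
Proof.
split=> [posA|[saA posA] x].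
  split=> [x y|x]; last first.
    by have := posA x; rewrite innerE lecE => /andP[].
  have im0 z : rip (A z) ('i *: z) = 0.
    by have := posA z; rewrite innerE lecE => /andP[/eqP].
  (* Polarization: the diagonal terms vanish and the cross terms give the symmetry of [A]. *)
  have := im0 (x + 'i *: y).
  rewrite (linearD A) (linearZ_LR A) /= scalerDr !ripDl !ripDr.
  rewrite !rip_i im0 (im0 y) add0r addr0 !scalerA -!expr2 sqr_i scaleN1r ripNr.
  rewrite -/(rip _ _) => h; rewrite [RHS]ripC; lra.
by rewrite innerE lecE /= posA sa_rip_i ?eqxx.
Qed.

Lemma pos_sa A : positive_op A -> sa A.
Proof. by case/positive_opP. Qed.

Lemma pos_ge0 A x : positive_op A -> 0 <= rip (A x) x.
Proof. by case/positive_opP. Qed.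

Lemma pos0 : positive_op (0 : bop H).
Proof. by move=> x; rewrite bopE linear0l. Qed.

Lemma pos1 : positive_op (1 : bop H).
Proof. by apply/positive_opP; split => // x; rewrite rip_xx_ge0. Qed.

Lemma posD A B : positive_op A -> positive_op B -> positive_op (A + B).
Proof.
move=> /positive_opP[sA hA] /positive_opP[sB hB]; apply/positive_opP; split.
  exact: saD.
by move=> x; rewrite bopE ripDl addr_ge0.
Qed.

Lemma posZ c A : 0 <= c -> positive_op A -> positive_op (c *: A).
Proof.
move=> c0 /positive_opP[saA hA]; apply/positive_opP; split; first exact: saZ.
by move=> x; rewrite !bopE !ripE mulr_ge0.
Qed.

Lemma pos_scalar c : 0 <= c -> positive_op (c%:Op : bop H).
Proof. by move=> c0; apply: posZ => //; exact: pos1. Qed.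

Lemma pos_sum (I : Type) (r : seq I) (F : I -> bop H) :
  (forall i, positive_op (F i)) -> positive_op (\sum_(i <- r) F i).
Proof.
by move=> hF; elim/big_ind: _ => // [|A B]; [exact: pos0|exact: posD].
Qed.

Lemma pos_conj C A : sa C -> positive_op A -> positive_op (C * A * C).
Proof.
move=> saC /positive_opP[saA hA]; apply/positive_opP; split.
  exact: sa_conj.
by move=> x; rewrite !bopE saC.
Qed.

Lemma pos_sqr C : sa C -> positive_op (C * C).
Proof. by move=> saC; rewrite -[C in C * _]mulr1; apply: pos_conj pos1. Qed.

Lemma pos_adj S S' A : is_adjoint S S' -> positive_op A ->
  positive_op (S' * A * S).
Proof. by move=> adj hA x; rewrite !bopE innerC -adj -innerC. Qed.

Lemma le_opE A B : le_op A B <-> positive_op (B - A).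
Proof.
by split=> h x; have := h x; rewrite !bopE linearBl subr_ge0.
Qed.

Lemma le_op0 A : le_op 0 A <-> positive_op A.
Proof. by rewrite le_opE subr0. Qed.

Lemma le_op_refl A : le_op A A. Proof. by []. Qed.

Lemma le_op_trans B A C : le_op A B -> le_op B C -> le_op A C.
Proof. by move=> AB BC x; apply: le_trans (AB x) (BC x). Qed.

Lemma le_rip A B x : le_op A B -> rip (A x) x <= rip (B x) x.
Proof. by move=> /(_ x); rewrite lecE => /andP[]. Qed.

Lemma le_opI A B : sa A -> sa B ->
  (forall x, rip (A x) x <= rip (B x) x) -> le_op A B.
Proof.
move=> saA saB' h; apply/le_opE/positive_opP; split; first exact: saB.
by move=> x; rewrite !bopE ripBl subr_ge0.
Qed.

(** At [x + D x] the form reduces to two equal cross terms, which add up to [2 |D x|^2]. *)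
Lemma sa_zero D : sa D -> (forall x, rip (D x) x = 0) -> D = 0.
Proof.
move=> saD q0; apply/bop_eqP => x; apply: rip_xx_eq0.
have := q0 (x + D x).
rewrite (linearD D) ripDl !ripDr !q0 (saD (D x) x) add0r addr0; lra.
Qed.

Lemma le_op_anti A B : le_op A B -> le_op B A -> A = B.
Proof.
move=> /le_opE AB /le_opE BA; apply/esym/subr0_eq/sa_zero => [|x].
  exact: pos_sa.
apply/eqP; rewrite eq_le pos_ge0// andbT.
by have := pos_ge0 x BA; rewrite -(opprB B A) bop_oppE ripNl oppr_ge0.
Qed.

Lemma le_opD A B C D : le_op A B -> le_op C D -> le_op (A + C) (B + D).
Proof. by move=> h k x; rewrite !bopE !linearDl; apply: lerD (h x) (k x). Qed.

Lemma le_opBl A B C : le_op A (B + C) -> le_op (A - B) C.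
Proof. by move=> /le_opE h; apply/le_opE; rewrite opprB addrCA addrA. Qed.

Lemma le_opN A B : le_op A B -> le_op (- B) (- A).
Proof. by move=> h x; rewrite !bopE !linearNl lerN2; exact: h. Qed.

Lemma le_opZ c A B : 0 <= c -> le_op A B -> le_op (c *: A) (c *: B).
Proof. by move=> c0 /le_opE h; apply/le_opE; rewrite -scalerBr; apply: posZ. Qed.

Lemma le_opZl c d A : c <= d -> positive_op A -> le_op (c *: A) (d *: A).
Proof.
by move=> cd h; apply/le_opE; rewrite -scalerBl; apply: posZ; rewrite ?subr_ge0.
Qed.

Lemma le_op_sum (I : Type) (r : seq I) (F G : I -> bop H) :
  (forall i, le_op (F i) (G i)) -> le_op (\sum_(i <- r) F i) (\sum_(i <- r) G i).
Proof.
by move=> hF; elim/big_ind2: _ => // A B C D; exact: le_opD.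
Qed.

Lemma le_op_conj C A B : sa C -> le_op A B -> le_op (C * A * C) (C * B * C).
Proof.
move=> saC /le_opE h; apply/le_opE.
by rewrite -mulrBl -mulrBr; apply: pos_conj.
Qed.

Lemma le_op_adj S S' A B : is_adjoint S S' -> le_op A B ->
  le_op (S' * A * S) (S' * B * S).
Proof.
move=> adj /le_opE h; apply/le_opE.
by rewrite -mulrBl -mulrBr; apply: pos_adj adj _.
Qed.

Lemma pos_le A B : positive_op A -> le_op A B -> positive_op B.
Proof. by move=> /le_op0 A0 AB; apply/le_op0/(le_op_trans A0). Qed.

Lemma quadratic_discr (a b d : R) : 0 <= d ->
  (forall t, 0 <= a + 2 * t * b + t ^+ 2 * d) -> b ^+ 2 <= a * d.
Proof.
rewrite le_eqVlt => /predU1P[<- h|d0 h].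
  suff -> : b = 0 by rewrite mulr0 expr0n.
  (* For [d = 0] the polynomial is affine in [t]; unless [b = 0], this [t] gives it the value -1. *)
  apply/eqP/negP => /negP b0; have := h (- (a + 1) / (2 * b)).
  have -> : a + 2 * (- (a + 1) / (2 * b)) * b + (- (a + 1) / (2 * b)) ^+ 2 * 0
    = -1 by field.
  by rewrite oppr_ge0 ler10.
have := h (- b / d).
have -> : a + 2 * (- b / d) * b + (- b / d) ^+ 2 * d = (a * d - b ^+ 2) / d.
  by field; rewrite gt_eqF.
by rewrite pmulr_lge0 ?invr_gt0// subr_ge0.
Qed.

Lemma pos_CS T x y : positive_op T ->
  rip (T x) y ^+ 2 <= rip (T x) x * rip (T y) y.
Proof.
move=> pT; apply: quadratic_discr; first exact: pos_ge0.
move=> t; have := pos_ge0 (x + t%:C *: y) pT.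
rewrite linearD linearZ !ripE (pos_sa pT y x) (ripC y); lra.
Qed.

Lemma rip_CS x y : rip x y ^+ 2 <= rip x x * rip y y.
Proof. exact: (pos_CS x y pos1). Qed.

Lemma rip_le x y : `|rip x y| <= nrm x * nrm y.
Proof.
rewrite -ler_sqr ?nnegrE ?mulr_ge0 ?nrm_ge0//.
by rewrite -normrX ger0_norm ?sqr_ge0// exprMn -!rip_nrm rip_CS.
Qed.

(** Cauchy-Schwarz for the form of [T] at [x] and [T x] gives [|T x|^4 <= <T x, x> <T T x, T x>],
    and the last factor is at most [c |T x|^2]. In operator terms this is [T^2 <= c T], obtained
    without a square root of [T]. *)
Lemma pos_sqr_le T c x : positive_op T -> le_op T c%:Op ->
  rip (T x) (T x) <= c * rip (T x) x.
Proof.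
move=> pT Tc; have := pos_CS x (T x) pT.
have := le_rip (T x) Tc; rewrite !bopE ripZl.
have := rip_xx_ge0 (T x); have := pos_ge0 x pT.
set a := rip (T x) (T x); set b := rip (T x) x; set d := rip (T (T x)) _.
move=> b0; rewrite le_eqVlt => /predU1P[<-|a0] dc h.
  (* If [T x = 0] there is nothing to divide by. The sign of [c] is free, but [0 <= T <= c] with
     [c < 0] forces [b = 0]. *)
  have [//|] := leP 0 (c * b); have [c0|c0] := leP 0 c.
    by rewrite ltNge mulr_ge0.
  have := le_rip x Tc; rewrite -/b !bopE ripZl; have := rip_xx_ge0 x; nra.
have : a ^+ 2 <= b * (c * a) by apply: le_trans h _; rewrite ler_wpM2l.
by rewrite expr2 mulrA ler_pM2r// mulrC.
Qed.

Lemma pos_nrm_le T c x : 0 <= c -> positive_op T -> le_op T c%:Op ->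
  nrm (T x) <= c * nrm x.
Proof.
move=> c0 pT Tc; apply: nrm_le; first by rewrite mulr_ge0 ?nrm_ge0.
apply: le_trans (pos_sqr_le x pT Tc) _.
rewrite exprMn -rip_nrm expr2 -mulrA ler_wpM2l//.
by have := le_rip x Tc; rewrite !bopE ripZl.
Qed.

Lemma sa_le A : sa A -> exists2 c, 0 < c & le_op (- c)%:Op A /\ le_op A c%:Op.
Proof.
move=> saA; have [c c0 Ac] := bop_bound A; exists c => //.
have h x : `|rip (A x) x| <= c * rip x x.
  rewrite (le_trans (rip_le _ _))// rip_nrm expr2 mulrA ler_wpM2r ?nrm_ge0//.
by split; apply: le_opI => // [|x]; try (by apply: saZ);
  rewrite !bopE ripZl; have := h x; rewrite ler_norml => /andP[]; lra.
Qed.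

Lemma pos_zero T x : positive_op T -> rip (T x) x = 0 -> T x = 0.
Proof.
move=> pT h; have := pos_CS x (T x) pT; rewrite h mul0r => h0.
apply: rip_xx_eq0; apply/eqP.
by rewrite -sqrf_eq0 eq_le h0 sqr_ge0.
Qed.

End PositiveOperators.

(** * Strong convergence *)

Section StrongConvergence.
Context {R : realType} {H : hilbertType R}.
Implicit Types (A B C D T : bop H) (X Y Z : nat -> bop H) (x y : H) (c : R).

(** The norm of [H] is [R[i]]-valued, and a positive element of [R[i]] has zero imaginary part, so
    real radii suffice. *)
Lemma hcvgP (u : nat -> H) (l : H) :
  u @ \oo --> l <-> nrm (u k - l) @[k --> \oo] --> (0 : R).
Proof.
split=> ul.
  apply/cvgrPdist_lt => e e0; have e0' : 0 < e%:C by rewrite ltcR.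
  move/cvgrPdist_lt : ul => /(_ _ e0'); apply: filterS => k.
  by rewrite -normrN opprB nrmE ltcR sub0r normrN ger0_norm// nrm_ge0.
apply/cvgrPdist_lt => -[e e']; rewrite ltcE /= => /andP[/eqP -> e0].
move/cvgrPdist_lt : ul => /(_ _ e0); apply: filterS => k.
by rewrite sub0r normrN ger0_norm ?nrm_ge0// -normrN opprB nrmE ltcR.
Qed.

Lemma rip_cvg (u : nat -> H) (l y : H) : u @ \oo --> l ->
  rip (u k) y @[k --> \oo] --> rip l y.
Proof.
move=> /hcvgP ul; apply: cvg_sub0 (cvg_cst (rip l y)) => /=.
apply/norm_cvg0P.
apply: (@squeeze_cvgr _ _ _ _ (cst 0) (fun k => nrm (u k - l) * nrm y)).
- apply: nearW => k; rewrite normr_ge0 /=.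
  by rewrite -[X in `|X|]/(rip (u k) y - rip l y) -ripBl rip_le.
- exact: cvg_cst.
- by rewrite -[X in _ --> X](mul0r (nrm y)); apply: cvgMl.
Qed.

Lemma bop_cvg A (u : nat -> H) (l : H) : u @ \oo --> l ->
  A (u k) @[k --> \oo] --> A l.
Proof.
move=> /hcvgP ul; apply/hcvgP; have [c _ Ac] := bop_bound A.
apply: (@squeeze_cvgr _ _ _ _ (cst 0) (fun k => c * nrm (u k - l))).
- by apply: nearW => k; rewrite nrm_ge0 -linearB Ac.
- exact: cvg_cst.
- by rewrite -[X in _ --> X](mulr0 c); apply: cvgMr.
Qed.

Lemma sot_unique X A B : sot_cvg X A -> sot_cvg X B -> A = B.
Proof.
move=> XA XB; apply/bop_eqP => x.
exact: (cvg_unique (@norm_hausdorff _ _) (XA x) (XB x)).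
Qed.

Lemma sot_cst A : sot_cvg (fun=> A) A.
Proof. by move=> x; exact: cvg_cst. Qed.

Lemma sotD X Y A B : sot_cvg X A -> sot_cvg Y B ->
  sot_cvg (fun k => X k + Y k) (A + B).
Proof. by move=> XA YB x; exact: cvgD (XA x) (YB x). Qed.

Lemma sotN X A : sot_cvg X A -> sot_cvg (fun k => - X k) (- A).
Proof. by move=> XA x; exact: cvgN (XA x). Qed.

Lemma sotB X Y A B : sot_cvg X A -> sot_cvg Y B ->
  sot_cvg (fun k => X k - Y k) (A - B).
Proof. by move=> XA YB; exact/sotD/sotN. Qed.

Lemma sotZ c X A : sot_cvg X A -> sot_cvg (fun k => c *: X k) (c *: A).
Proof. by move=> XA x; exact: cvgZr (XA x). Qed.

Lemma sotMl C X A : sot_cvg X A -> sot_cvg (fun k => C * X k) (C * A).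
Proof. by move=> XA x; exact: bop_cvg (XA x). Qed.

Lemma sotMr C X A : sot_cvg X A -> sot_cvg (fun k => X k * C) (A * C).
Proof. by move=> XA x; exact: XA (C x). Qed.

(** Products are not jointly continuous for the strong topology in general; the uniform bound on the
    left factors is what controls [X k (Y k x - B x)]. *)
Lemma sotM c X Y A B : (forall k x, nrm (X k x) <= c * nrm x) ->
  sot_cvg X A -> sot_cvg Y B -> sot_cvg (fun k => X k * Y k) (A * B).
Proof.
move=> Xc XA YB x; apply/hcvgP.
have /hcvgP h1 := XA (B x); have /hcvgP h2 := YB x.
apply: (@squeeze_cvgr _ _ _ _ (cst 0)
  (fun k => c * nrm (Y k x - B x) + nrm (X k (B x) - A (B x)))).
- apply: nearW => k; rewrite nrm_ge0 /=.
  rewrite -[X k (Y k x)](subrK (X k (B x))) -addrA (le_trans (nrmD _ _))//.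
  by rewrite lerD2r -(linearB (X k)); exact: Xc.
- exact: cvg_cst.
- rewrite -[X in _ --> X](addr0 0) -[X in _ --> X + _](mulr0 c).
  by apply: cvgD h1; exact: cvgMr.
Qed.

Lemma sot_shift X A : sot_cvg X A -> sot_cvg (fun k => X k.+1) A.
Proof. by move=> XA x; rewrite (cvg_shiftS (fun k => X k x)); exact: XA. Qed.

Lemma sot_pos X A : (forall k, positive_op (X k)) -> sot_cvg X A ->
  positive_op A.
Proof.
move=> Xp XA; apply/positive_opP; split=> [x y|x].
  have h1 := @rip_cvg _ _ y (XA x); have h2 := @rip_cvg _ _ x (XA y).
  rewrite [RHS]ripC; apply: cvg_unique h1 _ => //.
  apply: cvg_trans h2; apply: near_eq_cvg; apply: nearW => k /=.
  by rewrite (pos_sa (Xp k)) ripC.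
apply: (cvgr_to_ge (@rip_cvg _ _ x (XA x))).
by apply: nearW => k; exact: pos_ge0.
Qed.

Lemma sot_le X Y A B : (forall k, le_op (X k) (Y k)) ->
  sot_cvg X A -> sot_cvg Y B -> le_op A B.
Proof.
move=> XY XA YB; apply/le_opE.
by apply: sot_pos (sotB YB XA) => k; apply/le_opE.
Qed.

Lemma sot_comm C X A : (forall k, C * X k = X k * C) -> sot_cvg X A ->
  C * A = A * C.
Proof.
move=> CX XA; apply: (@sot_unique (fun k => C * X k)); first exact: sotMl.
by under eq_fun do rewrite CX; exact: sotMr.
Qed.

Lemma decreasing_le X A : (forall k l, (k <= l)%N -> le_op (X l) (X k)) ->
  sot_cvg X A -> forall k, le_op A (X k).
Proof.
move=> Xd XA k; have XA' : sot_cvg (fun l => X (l + k)%N) A.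
  by move=> x; rewrite (cvg_shiftn k (fun k => X k x)); exact: XA.
by apply: (sot_le _ XA' (@sot_cst (X k))) => l; apply: Xd; rewrite leq_addl.
Qed.

Lemma increasing_le X A : (forall k l, (k <= l)%N -> le_op (X k) (X l)) ->
  sot_cvg X A -> forall k, le_op (X k) A.
Proof.
move=> Xd XA k; have XA' : sot_cvg (fun l => X (l + k)%N) A.
  by move=> x; rewrite (cvg_shiftn k (fun k => X k x)); exact: XA.
by apply: (sot_le _ (@sot_cst (X k)) XA') => l; apply: Xd; rewrite leq_addl.
Qed.

Lemma sot_limit X c : (forall k x, nrm (X k x) <= c * nrm x) ->
  (forall x, cvgn (fun k => X k x)) -> exists A, sot_cvg X A.
Proof.
move=> Xc Xcvg; pose f x := limn (fun k => X k x).
have fE x : X k x @[k --> \oo] --> f x by exact: Xcvg.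
have fl : linear f.
  move=> a x y; apply: (cvg_unique (@norm_hausdorff _ _) (fE (a *: x + y))).
  have -> : (fun k => X k (a *: x + y)) = (fun k => a *: X k x + X k y).
    by apply/funext => k; rewrite linearP.
  by apply: cvgD (fE y); exact: cvgZr (fE x).
have fb : exists c : R[i], forall x, `|f x| <= c * `|x|.
  apply: (@bounded_nrm _ _ f c) => x.
  have [c0|c0] := leP 0 (c * nrm x); last first.
    by have := le_lt_trans (Xc 0%N x) c0; rewrite ltNge nrm_ge0.
  apply/ler_addgt0Pr => e e0; have /hcvgP/cvgrPdist_lt/(_ _ e0) := fE x.
  move=> -[N _ /(_ N (leqnn _))] /=.
  rewrite sub0r normrN ger0_norm ?nrm_ge0// => h.
  rewrite -[f x](subKr (X N x)) (le_trans (nrmB _ _))//.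
  by rewrite lerD// ltW.
by exists (BOp fl fb).
Qed.

(* Vigier's theorem: [|(X k - X l) x|^2 <= c <(X k - X l) x, x>], so that the
   convergence of the scalar sequence [<X k x, x>] forces that of [X k x]. *)
Lemma decreasing_cvg X : (forall k, positive_op (X k)) ->
  (forall k l, (k <= l)%N -> le_op (X l) (X k)) -> exists A, sot_cvg X A.
Proof.
move=> Xp Xd; have [c c0 [_ X0c]] := sa_le (pos_sa (Xp 0%N)).
have Xc k : le_op (X k) c%:Op by apply: le_op_trans X0c; exact: Xd.
apply: (@sot_limit X c) => [k x|x]; first by apply: pos_nrm_le => //; exact: ltW.
pose a k := rip (X k x) x.
have a_dec : nonincreasing_seq a by move=> k l kl; exact: le_rip (Xd _ _ kl).
have a_lb : has_lbound (range a).
  by exists 0 => _ [k _ <-]; exact: pos_ge0.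
have := nonincreasing_cvgn a_dec a_lb; set L := inf _ => aL.
have La k : L <= a k by apply: ge_inf => //; exists k.
apply: cauchy_cvg; apply: cauchy_exP => -[e e'].
rewrite ltcE /= => /andP[/eqP -> e0].
(* If the scalar sequence falls by less than [e ^+ 2 / c], the vectors move by less than [e]. *)
have e1 : 0 < e ^+ 2 / c by rewrite divr_gt0 ?exprn_gt0.
move/cvgrPdist_lt : aL => /(_ _ e1)[N _ NaL].
exists (X N x); exists N => // l /= Nl; rewrite -ball_normE /= nrmE ltcR.
rewrite -ltr_sqr ?nnegrE ?nrm_ge0 ?ltW// -rip_nrm.
have /le_opE D0 := Xd _ _ Nl.
have Dc : le_op (X N - X l) c%:Op.
  apply: le_op_trans (Xc N); apply/le_opE.
  by rewrite opprB addrC subrK.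
have := pos_sqr_le x D0 Dc; rewrite !bopE => /le_lt_trans; apply.
have := NaL N (leqnn _); rewrite /= distrC ger0_norm ?subr_ge0 ?La//.
rewrite ltr_pdivlMr// mulrC; apply: le_lt_trans.
by rewrite ler_wpM2l ?(ltW c0)// ripBl lerD2l lerN2 La.
Qed.

Lemma decreasing_cvg_ge X c : (forall k, le_op c%:Op (X k)) ->
  (forall k l, (k <= l)%N -> le_op (X l) (X k)) -> exists A, sot_cvg X A.
Proof.
move=> Xc Xd; have [||A XA] := @decreasing_cvg (fun k => X k - c%:Op).
- by move=> k; exact/le_opE.
- by move=> k l kl; apply: le_opD => //; exact: Xd.
exists (A + c%:Op); have := sotD XA (@sot_cst c%:Op).
by under eq_fun do rewrite subrK.
Qed.

Lemma increasing_cvg_le X c : (forall k, le_op (X k) c%:Op) ->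
  (forall k l, (k <= l)%N -> le_op (X k) (X l)) -> exists A, sot_cvg X A.
Proof.
move=> Xc Xd; have [||A XA] := @decreasing_cvg (fun k => c%:Op - X k).
- by move=> k; exact/le_opE.
- by move=> k l kl; apply: le_opD => //; apply/le_opN/Xd.
exists (c%:Op - A); have := sotB (@sot_cst c%:Op) XA.
by under eq_fun do rewrite subKr.
Qed.

End StrongConvergence.

(** * Square roots and spectral projections *)

Section FunctionalCalculus.
Context {R : realType} {H : hilbertType R}.
Implicit Types (A B C D E N P Q T : bop H) (X Y Z : nat -> bop H) (c : R).

(** The bicommutant of [A]. It is closed under algebra and strong limits and its members commute
    with each other, so operators built from [A] need no separate commutation proofs. *)
Definition bicomm A T : Prop := forall C, GRing.comm C A -> GRing.comm C T.

Lemma bicomm_comm A S T : bicomm A S -> bicomm A T -> GRing.comm S T.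
Proof. by move=> hS hT; apply/hT/commr_sym/hS. Qed.

Lemma bicomm_refl A : bicomm A A. Proof. by []. Qed.

Lemma bicomm_trans A B C : bicomm A B -> bicomm B C -> bicomm A C.
Proof. by move=> AB BC D DA; exact/BC/AB. Qed.

Lemma bicomm1 A : bicomm A 1.
Proof. by move=> C _; exact: commr1. Qed.

Lemma bicommD A S T : bicomm A S -> bicomm A T -> bicomm A (S + T).
Proof. by move=> hS hT C CA; apply: commrD; [exact: hS|exact: hT]. Qed.

Lemma bicommN A S : bicomm A S -> bicomm A (- S).
Proof. by move=> hS C CA; apply: commrN; exact: hS. Qed.

Lemma bicommB A S T : bicomm A S -> bicomm A T -> bicomm A (S - T).
Proof. by move=> hS hT; apply/bicommD/bicommN. Qed.

Lemma bicommM A S T : bicomm A S -> bicomm A T -> bicomm A (S * T).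
Proof. by move=> hS hT C CA; apply: commrM; [exact: hS|exact: hT]. Qed.

Lemma bicommZ c A S : bicomm A S -> bicomm A (c *: S).
Proof.
by move=> hS C CA; rewrite /GRing.comm -bop_scaleAr -bop_scaleAl (hS C CA).
Qed.

Lemma bicommX A S n : bicomm A S -> bicomm A (S ^+ n).
Proof. by move=> hS C CA; apply: commrX; exact: hS. Qed.

Lemma bicomm_sot A X T : (forall k, bicomm A (X k)) -> sot_cvg X T ->
  bicomm A T.
Proof. by move=> hX XT C CA; apply: (@sot_comm _ _ _ X) => // k; exact: hX. Qed.

(* The sequence [A, A - A^2, ...] exhibits [A] as the sum of the squares of its
   terms, all of which commute with [B] (Riesz and Nagy). *)
Lemma pos_mul_le1 A B : positive_op A -> le_op A 1 -> positive_op B ->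
  GRing.comm B A -> positive_op (A * B).
Proof.
move=> pA A1 pB AB; pose X n := iter n (fun T => T - T * T) A.
have XS n : X n.+1 = X n - X n * X n by [].
have bX n : bicomm A (X n).
  elim: n => [|n IHn]; first exact: bicomm_refl.
  by rewrite XS; apply: bicommB => //; exact: bicommM.
have pX n : positive_op (X n) /\ le_op (X n) 1.
  elim: n => [//|n [pXn /le_opE Xn1]].
  have saX := pos_sa pXn; have saX1 := pos_sa Xn1.
  rewrite XS; split; last first.
    by apply/le_opE; rewrite opprB addrCA addrC; apply: posD => //; exact: pos_sqr.
  (* The identity [t - t^2 = t (1 - t) t + (1 - t) t (1 - t)] displays a sum of conjugates of
     positive operators. *)
  suff -> : X n - X n * X n =
      X n * (1 - X n) * X n + (1 - X n) * X n * (1 - X n).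
    by apply: posD; exact: pos_conj.
  rewrite !(mulrBr, mulrBl, mulr1, mul1r).
  by rewrite [RHS]addrC subrK.
have X_dec k l : (k <= l)%N -> le_op (X l) (X k).
  move=> /subnK <-; elim: (l - k)%N => [//|m IHm].
  apply: le_op_trans IHm; rewrite addSn XS; apply/le_opE.
  by rewrite subKr; apply: pos_sqr; apply: pos_sa; case: (pX (m + k)%N).
have [L XL] := decreasing_cvg (fun k => (pX k).1) X_dec.
have L0 : L = 0.
  have XX : sot_cvg (fun k => X k * X k) (L * L).
    apply: (@sotM _ _ 1) => // k x; apply: pos_nrm_le => //.
    - by case: (pX k).
    - by rewrite scale1r; case: (pX k).
  have : L = L - L * L.
    by apply: (sot_unique (sot_shift XL)); exact: sotB.
  move/eqP; rewrite -subr_eq0 opprB addrC subrK => /eqP LL.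
  have saL := pos_sa (sot_pos (fun k => (pX k).1) XL).
  apply/bop_eqP => x; apply: rip_xx_eq0.
  by rewrite saL -bop_mulE LL rip0r.
have cB n : GRing.comm B (X n) by apply: bX.
(* The squares [X i * X i = X i - X i.+1] telescope, and [B] may be moved between the two
   factors. *)
have decomp n : A * B - B * X n = \sum_(i < n) X i * B * X i.
  elim: n => [|n IHn].
    by rewrite big_ord0 -[X 0%N]/A AB subrr.
  rewrite XS big_ord_recr -IHn mulrBr -(cB n) mulrA.
  by rewrite opprB addrA addrAC.
have : sot_cvg (fun n => A * B - B * X n) (A * B - B * L).
  by apply: sotB; [exact: sot_cst|exact: sotMl].
rewrite L0 mulr0 subr0; apply: sot_pos => n; rewrite decomp.
by apply: pos_sum => i; apply: pos_conj => //; apply: pos_sa; case: (pX i).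
Qed.

Lemma pos_mul A B : positive_op A -> positive_op B -> GRing.comm A B ->
  positive_op (A * B).
Proof.
move=> pA pB AB; have [c c0 [_ Ac]] := sa_le (pos_sa pA).
have -> : A * B = c *: ((c^-1 *: A) * B).
  by rewrite -bop_scaleAl scalerA mulfV ?scale1r// gt_eqF.
apply: posZ; first exact: ltW.
apply: pos_mul_le1 => //.
- by apply: posZ => //; rewrite invr_ge0 ltW.
- rewrite -[1]scale1r -(mulVf (lt0r_neq0 c0)) -scalerA.
  by apply: le_opZ => //; rewrite invr_ge0 ltW.
- by apply: bicommZ (commr_sym AB); exact: bicomm_refl.
Qed.

Lemma le_op_mul C A B : positive_op C -> GRing.comm C A -> GRing.comm C B ->
  le_op A B -> le_op (C * A) (C * B).
Proof.
move=> pC CA CB /le_opE AB; apply/le_opE; rewrite -mulrBr.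
by apply: pos_mul => //; exact: commrB.
Qed.

Lemma pos_exp A n : positive_op A -> positive_op (A ^+ n).
Proof.
move=> pA; elim: n => [|n IHn]; first exact: pos1.
by rewrite exprS; apply: pos_mul => //; exact: commrX.
Qed.

(* [1 - Y] is a square root of [A] when [Y = (1 - A + Y^2) / 2]. *)
Lemma sqrt_le1 A : positive_op A -> le_op A 1 ->
  exists S, [/\ positive_op S, S * S = A & bicomm A S].
Proof.
move=> pA A1; pose N := 1 - A.
have pN : positive_op N by apply/le_opE.
have bN : bicomm A N by apply: bicommB; [exact: bicomm1|exact: bicomm_refl].
have h0 : 0 <= 2^-1 :> R by rewrite invr_ge0.
pose Y n := iter n (fun T => 2^-1 *: (N + T * T)) 0.
have YS n : Y n.+1 = 2^-1 *: (N + Y n * Y n) by [].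
have bY n : bicomm A (Y n).
  elim: n => [|n IHn]; first by move=> C _; exact: commr0.
  by rewrite YS; apply/bicommZ/bicommD => //; exact: bicommM.
have pY n : positive_op (Y n).
  elim: n => [|n IHn]; first exact: pos0.
  by rewrite YS; apply: posZ => //; apply: posD => //; apply/pos_sqr/pos_sa.
have Y1 n : le_op (Y n) 1.
  elim: n => [|n IHn]; first exact/le_op0/pos1.
  have YY : le_op (Y n * Y n) 1.
    apply: (le_op_trans _ IHn); rewrite -[X in le_op _ X]mulr1.
    by apply: le_op_mul => //; exact: commr1.
  have -> : (1 : bop H) = 2^-1 *: ((1 : bop H) + (1 : bop H)).
    by rewrite -mulr2n -(scaler_nat 2 (1 : bop H)) scalerA mulVf ?scale1r// pnatr_eq0.
  rewrite YS; apply: le_opZ => //; apply: le_opD => //; apply/le_opE.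
  by rewrite subKr.
have YY n : le_op (Y n) (Y n.+1).
  elim: n => [|n /le_opE IHn]; first exact/le_op0/pY.
  apply/le_opE.
  (* A difference of squares factors here because the iterates commute. *)
  have -> : Y n.+2 - Y n.+1 = 2^-1 *: ((Y n.+1 - Y n) * (Y n.+1 + Y n)).
    rewrite (YS n.+1) [in X in _ - X](YS n) -scalerBr; congr (_ *: _).
    rewrite opprD addrACA subrr add0r mulrBl !mulrDr opprD.
    by rewrite (bicomm_comm (bY n.+1) (bY n)) addrA addrK.
  apply: posZ => //; apply: pos_mul => //; first exact: posD.
  by apply: bicomm_comm; [exact: bicommB|exact: bicommD].
have Y_inc k l : (k <= l)%N -> le_op (Y k) (Y l).
  move=> /subnK <-; elim: (l - k)%N => [//|m IHm].
  by apply: le_op_trans IHm _; rewrite addSn.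
have [L YL] : exists L, sot_cvg Y L.
  by apply: (@increasing_cvg_le _ _ _ 1) => // k; rewrite scale1r.
have LE : L = 2^-1 *: (N + L * L).
  apply: (sot_unique (sot_shift YL)); apply: sotZ.
  apply: sotD; first exact: sot_cst.
  apply: (@sotM _ _ 1) => // k x; apply: pos_nrm_le => //.
  by rewrite scale1r.
exists (1 - L); split.
- apply/le_opE; rewrite -[X in le_op _ X]scale1r.
  by apply: (sot_le _ YL (@sot_cst _ _ _)) => k; rewrite scale1r.
- have L2 : L + L = N + L * L.
    rewrite [in LHS]LE -scalerDl.
    by have -> : 2^-1 + 2^-1 = 1 :> R; [field|rewrite scale1r].
  rewrite mulrBl mul1r mulrBr mulr1 opprB addrA addrAC -(addrA 1) -opprD L2.
  by rewrite opprD addrA subrK /N subKr.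
- by apply: bicommB; [exact: bicomm1|exact: bicomm_sot bY YL].
Qed.

Lemma sqrt_exists A : positive_op A ->
  exists S, [/\ positive_op S, S * S = A & bicomm A S].
Proof.
move=> pA; have [c c0 [_ Ac]] := sa_le (pos_sa pA).
have [|| S [pS SS bS]] := @sqrt_le1 (c^-1 *: A).
- by apply: posZ => //; rewrite invr_ge0 ltW.
- rewrite -[1]scale1r -(mulVf (lt0r_neq0 c0)) -scalerA.
  by apply: le_opZ => //; rewrite invr_ge0 ltW.
exists (Num.sqrt c *: S); split.
- by apply: posZ => //; exact: sqrtr_ge0.
- rewrite -bop_scaleAl -bop_scaleAr SS !scalerA -expr2 sqr_sqrtr ?ltW//.
  by rewrite mulfV ?scale1r// gt_eqF.
- by apply: bicommZ; apply: bicomm_trans bS; exact/bicommZ/bicomm_refl.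
Qed.

End FunctionalCalculus.

(** * Inverses, spectral cuts and step approximations *)

Section SpectralSteps.
Context {R : realType} {H : hilbertType R}.
Implicit Types (A B C D E M N P Q T : bop H) (X Y Z : nat -> bop H) (c d : R).

(** A Neumann series run as an increasing sequence: [A = d (1 - N)] with [0 <= N <= q < 1], and the
    partial sums stay below the geometric sum [s = 1 / (1 - q) = d / c], so that monotone
    convergence applies. *)
Lemma pos_inverse A c : 0 < c -> le_op c%:Op A ->
  exists B, [/\ A * B = 1, B * A = 1 & positive_op B].
Proof.
move=> c0 cA.
have pA : positive_op A by apply: pos_le cA; apply: pos_scalar; exact: ltW.
have [d d0 [_ Ad]] := sa_le (pos_sa pA).
have d0' : 0 <= d^-1 by rewrite invr_ge0 ltW.
have dK : d^-1 *: d%:Op = 1 :> bop H by rewrite scalerA mulVf ?scale1r ?gt_eqF.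
pose q := 1 - c / d; pose N := 1 - d^-1 *: A.
have pN : positive_op N.
  by apply/le_opE; rewrite -dK; exact: le_opZ.
have Nq : le_op N q%:Op.
  rewrite /q scalerBl scale1r; apply: le_opD => //; apply: le_opN.
  by rewrite mulrC -scalerA; exact: le_opZ.
(* [q < 0] contradicts [0 <= N <= q] unless [H] is zero, where every operator is an inverse. *)
have [q1|q0] := leP 0 q; last first.
  suff A0 x : x = 0 :> H.
    exists 0; split; [| |exact: pos0]; apply/bop_eqP => x.
      by rewrite [LHS]A0 [RHS]A0.
    by rewrite [LHS]A0 [RHS]A0.
  apply: rip_xx_eq0; apply/eqP; rewrite eq_le rip_xx_ge0 andbT.
  have := le_rip x Nq; have := pos_ge0 x pN; rewrite !bopE !ripE.
  have := rip_xx_ge0 x; nra.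
pose s := d / c.
have sq : 1 + s * q = s by rewrite /s /q; field; rewrite !gt_eqF.
pose X n := iter n (fun T => 1 + N * T) 0.
have XS n : X n.+1 = 1 + N * X n by [].
have bX n : bicomm N (X n).
  elim: n => [|n IHn]; first by move=> C _; exact: commr0.
  by rewrite XS; apply/bicommD/bicommM => //; exact: bicomm1.
have bs k : bicomm N k%:Op by apply/bicommZ/bicomm1.
have Xs n : le_op (X n) s%:Op.
  elim: n => [|n IHn]; first by apply/le_op0/pos_scalar; rewrite divr_ge0 ?ltW.
  rewrite XS -sq scalerDl scale1r; apply: le_opD => //.
  apply: (@le_op_trans _ _ (N * s%:Op)).
    apply: le_op_mul => //; first exact: bX.
    exact: bs.
  rewrite -bop_scaleAr mulr1 -scalerA; apply: le_opZ => //.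
  by rewrite divr_ge0 ?ltW.
have X_step n : le_op (X n) (X n.+1).
  elim: n => [|n IHn]; first by rewrite XS mulr0 addr0; apply/le_op0/pos1.
  rewrite (XS n.+1) [X in le_op X _](XS n); apply: le_opD => //.
  by apply: le_op_mul => //; exact: bX.
have X_inc k l : (k <= l)%N -> le_op (X k) (X l).
  move=> /subnK <-; elim: (l - k)%N => [//|m IHm].
  by apply: (le_op_trans IHm); rewrite addSn.
have [L XL] := increasing_cvg_le Xs X_inc.
have LE : L = 1 + N * L.
  apply: (sot_unique (sot_shift XL)); apply: sotD; first exact: sot_cst.
  exact: sotMl.
have bL : bicomm N L by exact: bicomm_sot bX XL.
have NL : (1 - N) * L = 1.
  by rewrite mulrBl mul1r [X in X - _]LE addrK.
have AN : A = d *: (1 - N).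
  by rewrite /N subKr scalerA mulfV ?scale1r// gt_eqF.
exists (d^-1 *: L); split.
- by rewrite AN -bop_scaleAl -bop_scaleAr NL scalerA mulfV ?scale1r// gt_eqF.
- rewrite AN -bop_scaleAl -bop_scaleAr.
  have -> : L * (1 - N) = (1 - N) * L.
    by apply: bicomm_comm bL _; apply: bicommB; [exact: bicomm1|exact: bicomm_refl].
  by rewrite NL scalerA mulVf ?scale1r// gt_eqF.
- apply: posZ => //; apply: pos_le (increasing_le X_inc XL 1%N).
  by rewrite XS mulr0 addr0; exact: pos1.
Qed.

(** An inverse [B] with bound [b] gives [|x| <= b |A x|], while [|A x|^2 <= d <A x, x>] when
    [A <= d]; together they yield the constant [(b ^+ 2 * d)^-1]. The converse is [pos_inverse]. *)
Lemma posinv_opP A :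
  posinv_op A <-> positive_op A /\ exists2 c, 0 < c & le_op c%:Op A.
Proof.
split=> [[pA [B [_ BA]]]|[pA [c c0 cA]]]; last first.
  by have [B [AB BA _]] := pos_inverse c0 cA; split=> //; exists B.
split=> //; have [b b0 Bb] := bop_bound B.
have [d d0 [_ Ad]] := sa_le (pos_sa pA).
exists (b ^+ 2 * d)^-1; first by rewrite invr_gt0 mulr_gt0 ?exprn_gt0.
apply: le_opI; [exact/saZ|exact: pos_sa|move=> x].
rewrite !bopE ripZl ler_pdivrMl ?mulr_gt0 ?exprn_gt0//.
have xE : x = B (A x) by rewrite -bop_mulE [X in _ = bop_fun X x]BA.
apply: (@le_trans _ _ (b ^+ 2 * rip (A x) (A x))).
  rewrite {1 2}xE !rip_nrm -exprMn ler_sqr ?nnegrE ?nrm_ge0//.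
  by rewrite mulr_ge0 ?nrm_ge0// ltW.
by rewrite -(mulrA (b ^+ 2)) ler_wpM2l ?sqr_ge0//; apply: pos_sqr_le.
Qed.

Lemma posinv_pos A : posinv_op A -> positive_op A. Proof. by case. Qed.

Lemma posinv_inverse A : posinv_op A ->
  exists B, [/\ A * B = 1, B * A = 1 & positive_op B].
Proof. by move=> /posinv_opP[_ [c c0 cA]]; exact: pos_inverse cA. Qed.

Lemma posinv_le A B : posinv_op A -> le_op A B -> posinv_op B.
Proof.
move=> /posinv_opP[pA [c c0 cA]] AB; apply/posinv_opP; split.
  exact: pos_le AB.
by exists c => //; exact: le_op_trans AB.
Qed.

Lemma posinv_scalar c : 0 < c -> posinv_op (c%:Op : bop H).
Proof.
move=> c0; apply/posinv_opP; split; first by apply/pos_scalar/ltW.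
by exists c.
Qed.

(* [E] projects onto the kernel of [N = |D| - D].  It is the limit of the
   powers of [K = 1 - N^2 / c], and it fixes the range of [M = |D| + D] because
   [N * M = |D|^2 - D^2 = 0]. *)
Lemma spectral_cut D : sa D -> exists E, [/\ positive_op E, E * E = E,
  bicomm D E, positive_op (D * E) & positive_op (- (D * (1 - E)))].
Proof.
move=> saD; have [S [pS SS bS0]] := sqrt_exists (pos_sqr saD).
have bS : bicomm D S.
  by apply: bicomm_trans bS0; apply: bicommM; exact: bicomm_refl.
have DS : GRing.comm D S by apply: bS; exact: commr_refl.
pose N := S - D; pose M := S + D.
have bN : bicomm D N by apply: bicommB => //; exact: bicomm_refl.
have saN : sa N by apply: saB => //; exact: pos_sa.
have MN : M * N = 0.
  by rewrite mulrDl !mulrBr SS DS addrA subrK subrr.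
have [c c0 [_ Nc]] := sa_le (pos_sa (pos_sqr saN)).
have c0' : 0 <= c^-1 by rewrite invr_ge0 ltW.
pose K := 1 - c^-1 *: (N * N).
have bK : bicomm D K.
  by apply: bicommB; [exact: bicomm1|apply/bicommZ/bicommM].
have pK : positive_op K.
  apply/le_opE; rewrite -[X in le_op _ X]scale1r -(mulVf (lt0r_neq0 c0)) -scalerA.
  exact: le_opZ.
have K1 : le_op K 1.
  by apply/le_opE; rewrite subKr; apply: posZ => //; exact: pos_sqr.
have pKn n : positive_op (K ^+ n) by exact: pos_exp.
have K_dec k l : (k <= l)%N -> le_op (K ^+ l) (K ^+ k).
  move=> /subnK <-; elim: (l - k)%N => [//|m IHm].
  apply: le_op_trans IHm; rewrite addSn exprSr -[X in le_op _ X]mulr1.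
  apply: le_op_mul => //; last exact: commr1.
  by apply/commr_sym/commrX/commr_refl.
have [E KE] := decreasing_cvg pKn K_dec.
have bE : bicomm D E by apply: bicomm_sot KE => k; exact: bicommX.
have KE_E : K * E = E.
  apply: sot_unique (sot_shift KE); under eq_fun do rewrite exprS.
  exact: sotMl.
have pE : positive_op E by exact: sot_pos KE.
have KnE n : K ^+ n * E = E.
  by elim: n => [|n IHn]; rewrite ?expr0 ?mul1r// exprS -mulrA IHn.
have EE : E * E = E.
  have : sot_cvg (fun n => K ^+ n * E) (E * E) by exact: sotMr.
  under eq_fun do rewrite KnE.
  by move=> h; apply: (sot_unique h); exact: sot_cst.
(* [K * E = E] only says that [N * N * E = 0]; self-adjointness of [N] removes the square. *)
have NE : N * E = 0.
  move/eqP : KE_E; rewrite mulrBl mul1r subr_eq addrC -subr_eq subrr eq_sym.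
  rewrite -bop_scaleAl => /eqP NNE.
  have {}NNE : N * N * E = 0.
    by rewrite -[LHS]scale1r -(mulfV (lt0r_neq0 c0)) -scalerA NNE scaler0.
  apply/bop_eqP => x; apply: rip_xx_eq0.
  rewrite !bopE saN; have -> : N (N (E x)) = (N * N * E) x by [].
  by rewrite NNE rip0r.
have ME : M * E = M.
  have : sot_cvg (fun n => M * K ^+ n) (M * E) by exact: sotMl.
  have -> : (fun n => M * K ^+ n) = (fun=> M).
    apply/funext => n; elim: n => [|n IHn]; first by rewrite mulr1.
    rewrite exprS mulrA mulrBr mulr1 -bop_scaleAr mulrA MN mul0r scaler0 subr0.
    exact: IHn.
  by move=> h; apply: (sot_unique h); exact: sot_cst.
have SE : S * E = D * E by apply/eqP; rewrite -subr_eq0 -mulrBl; apply/eqP.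
have pE' : positive_op (1 - E).
  have -> : 1 - E = (1 - E) * (1 - E).
    by rewrite mulrBl mul1r mulrBr mulr1 EE subrr subr0.
  by apply: pos_sqr; apply: saB => //; exact: pos_sa.
have cSE : GRing.comm S E by exact: bicomm_comm bS bE.
exists E; split => //; first by rewrite -SE; exact: pos_mul.
(* [M * E = M] means [(|D| + D) (1 - E) = 0], so [|D|] and [- D] agree on the range of [1 - E]. *)
have -> : - (D * (1 - E)) = S * (1 - E).
  rewrite !mulrBr !mulr1 opprB -SE; apply/eqP.
  by rewrite subr_eq addrAC -/M eq_sym subr_eq -[X in X == _]ME mulrDl SE.
apply: pos_mul => //; apply: commrB => //; exact: commr1.
Qed.

(** Members may be zero, as happens for a slice of an interval that meets no spectrum. *)
Definition orthogonal_projections n (P : 'I_n -> bop H) : Prop :=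
  (forall i, positive_op (P i)) /\
  (forall i j, P i * P j = if i == j then P i else 0).

Lemma orthogonal_mulr n (P : 'I_n -> bop H) (a : 'I_n -> R) i :
  orthogonal_projections P -> (\sum_j a j *: P j) * P i = a i *: P i.
Proof.
move=> [_ PP]; rewrite mulr_suml (bigD1 i)//= -bop_scaleAl PP eqxx big1 ?addr0//.
by move=> j ji; rewrite -bop_scaleAl PP (negPf ji) scaler0.
Qed.

Lemma orthogonal_mull n (P : 'I_n -> bop H) (a : 'I_n -> R) i :
  orthogonal_projections P -> P i * (\sum_j a j *: P j) = a i *: P i.
Proof.
move=> [_ PP]; rewrite mulr_sumr (bigD1 i)//= -bop_scaleAr PP eqxx big1 ?addr0//.
by move=> j ji; rewrite -bop_scaleAr PP eq_sym (negPf ji) scaler0.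
Qed.

(** Induction on the number of slices of width [d]: a cut of [T - (c + d)] splits off the lowest
    slice and leaves a remainder above [c + d]. Working below a projection [Q] instead of [1] makes
    the remainder [Q * E] an instance of the same statement. *)
Lemma orthogonal_split T d n : sa T -> 0 <= d ->
  forall c Q, positive_op Q -> Q * Q = Q -> bicomm T Q ->
    le_op (c *: Q) (T * Q) -> le_op (T * Q) ((c + n.+1%:R * d) *: Q) ->
  exists P : 'I_n.+1 -> bop H,
    [/\ orthogonal_projections P, \sum_(i < n.+1) P i = Q,
        le_op (\sum_(i < n.+1) (c + i%:R * d) *: P i) (T * Q) &
        le_op (T * Q) (\sum_(i < n.+1) (c + i%:R * d) *: P i + d *: Q)].
Proof.
move=> saT d0; elim: n => [|n IHn] c Q pQ QQ bQ cQ Qc.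
  exists (fun=> Q); rewrite !big_ord1 mul0r addr0; split => //.
    by split=> // i j; rewrite !ord1 eqxx.
  by rewrite -scalerDl; rewrite mul1r in Qc.
pose u := c + d.
have [|E [pE EE bE DE DE']] := @spectral_cut (T - u%:Op).
  by apply: saB => //; apply/saZ/sa1.
have bu : bicomm T (T - u%:Op).
  by apply: bicommB; [exact: bicomm_refl|apply/bicommZ/bicomm1].
have {bu}bE : bicomm T E by exact: bicomm_trans bE.
have uE : le_op (u *: E) (T * E).
  by apply/le_opE; rewrite mulrBl -bop_scaleAl mul1r in DE.
pose E' := 1 - E.
have uE' : le_op (T * E') (u *: E').
  by apply/le_opE; rewrite mulrBl -bop_scaleAl mul1r opprB in DE'.
have bE' : bicomm T E' by apply: bicommB => //; exact: bicomm1.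
have EE' : E * E' = 0 by rewrite mulrBr mulr1 EE subrr.
have E'E' : E' * E' = E' by rewrite {1}/E' mulrBl mul1r EE' subr0.
have pE' : positive_op E'.
  by rewrite -E'E'; apply/pos_sqr/saB; [exact: sa1|exact: pos_sa].
have bT := @bicomm_refl _ _ T.
have QE : GRing.comm Q E by exact: bicomm_comm bQ bE.
have QE' : GRing.comm Q E' by exact: bicomm_comm bQ bE'.
have TQ : GRing.comm T Q by exact: bicomm_comm bT bQ.
have compress F G a b : bicomm T F -> bicomm T G -> positive_op F ->
    (le_op (a *: G) (T * G) -> le_op (a *: (G * F)) (T * (G * F))) /\
    (le_op (T * G) (b *: G) -> le_op (T * (G * F)) (b *: (G * F))).
  move=> bF bG pF; have FT : GRing.comm F T by exact: bicomm_comm bF bT.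
  have FG : GRing.comm F G by exact: bicomm_comm bF bG.
  have E1 k : k *: (G * F) = F * (k *: G) by rewrite -bop_scaleAr FG.
  have E2 : T * (G * F) = F * (T * G) by rewrite mulrA (commrM FT FG).
  rewrite !E1 E2; split=> h; apply: le_op_mul => //; try exact: commrM;
    by apply: bicomm_comm bF _; exact: bicommZ.
have uQE : le_op (u *: (Q * E)) (T * (Q * E)).
  by rewrite QE; apply: (compress Q E u u _ _ _).1.
have uQE' : le_op (T * (Q * E')) (u *: (Q * E')).
  by rewrite QE'; apply: (compress Q E' u u _ _ _).2.
have cQE' : le_op (c *: (Q * E')) (T * (Q * E')).
  exact: (compress E' Q c c _ _ _).1.
have QEc : le_op (T * (Q * E)) ((u + n.+1%:R * d) *: (Q * E)).
  apply: (compress E Q c (u + n.+1%:R * d) _ _ _).2 => //.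
  suff -> : u + n.+1%:R * d = c + n.+2%:R * d by [].
  by rewrite /u -addrA -[n.+2%:R]natr1 mulrDl mul1r [d + _]addrC.
have pQE : positive_op (Q * E) by exact: pos_mul.
have QEQE : Q * E * (Q * E) = Q * E.
  by rewrite {1}QE mulrA -(mulrA E) QQ -QE -mulrA EE.
have bQE : bicomm T (Q * E) by exact: bicommM.
have [P [oP sP P1 P2]] := IHn u _ pQE QEQE bQE uQE QEc.
have [pP PP] := oP.
have sP1 : \sum_(i < n.+1) 1 *: P i = Q * E.
  by rewrite -sP; apply: eq_bigr => i _; rewrite scale1r.
have PQE j : P j * (Q * E) = P j.
  by rewrite -sP1 (orthogonal_mull (fun=> 1))// scale1r.
have QEP j : (Q * E) * P j = P j.
  by rewrite -sP1 (orthogonal_mulr (fun=> 1))// scale1r.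
have PQE' j : P j * (Q * E') = 0.
  by rewrite -PQE QE -(mulrA (P j)) -(mulrA E) (mulrA Q) QQ QE' mulrA mulrA
             -(mulrA (P j)) EE' mulr0 mul0r.
have QE'P j : (Q * E') * P j = 0.
  rewrite -QEP (mulrA (Q * E')) QE' -(mulrA E') (mulrA Q) QQ QE mulrA.
  by rewrite /E' mulrBl mul1r EE subrr !mul0r.
pose P' (i : 'I_n.+2) := if unlift ord0 i is Some j then P j else Q * E'.
have P'0 : P' ord0 = Q * E' by rewrite /P' unlift_none.
have P'S j : P' (lift ord0 j) = P j by rewrite /P' liftK.
have QEE' : Q * E' + Q * E = Q by rewrite -mulrDr subrK mulr1.
have TQE : T * Q = T * (Q * E') + T * (Q * E) by rewrite -mulrDr QEE'.
have sumE : \sum_(i < n.+2) (c + i%:R * d) *: P' i =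
    c *: (Q * E') + \sum_(i < n.+1) (u + i%:R * d) *: P i.
  rewrite big_ord_recl P'0 mul0r addr0; congr (_ + _); apply: eq_bigr => i _.
  rewrite P'S; congr (_ *: _); rewrite /u -addrA; congr (_ + _).
  by rewrite lift0 -natr1 mulrDl mul1r addrC.
exists P'; split.
- split=> [i|i j].
    by rewrite /P'; case: (unliftP ord0 i) => [k _|_] //; exact: pos_mul.
  rewrite /P'; case: (unliftP ord0 i) => [k ->|->];
    case: (unliftP ord0 j) => [l ->|->]; rewrite ?eqxx.
  + by rewrite (inj_eq lift_inj) PP.
  + by rewrite PQE'.
  + by rewrite QE'P.
  + by rewrite {1}QE' mulrA -(mulrA E') QQ -QE' -mulrA E'E'.
- rewrite big_ord_recl P'0 -[RHS]QEE'; congr (_ + _).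
  by rewrite -sP; apply: eq_bigr => i _; rewrite P'S.
- by rewrite sumE TQE; exact: le_opD.
- have -> : d *: Q = d *: (Q * E') + d *: (Q * E) by rewrite -scalerDr QEE'.
  by rewrite sumE TQE addrACA -scalerDl; exact: le_opD.
Qed.

(** Stands in for the spectral integral, as a lower sum with mesh [d]. *)
Lemma spectral_steps T a b n : a <= b -> (0 < n)%N -> sa T ->
  le_op a%:Op T -> le_op T b%:Op ->
  exists P : 'I_n -> bop H, let d := (b - a) / n%:R in
    let S := \sum_(i < n) (a + i%:R * d) *: P i in
    [/\ orthogonal_projections P, \sum_(i < n) P i = 1,
        le_op S T & le_op T (S + d%:Op)].
Proof.
case: n => // n ab _ saT aT Tb.
have d0 : 0 <= (b - a) / n.+1%:R by rewrite divr_ge0 ?subr_ge0.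
have [||P [oP sP P1 P2]] := orthogonal_split (n := n) saT d0 (c := a) pos1
    (mulr1 1) (@bicomm1 _ _ T).
- by rewrite mulr1.
- by rewrite mulr1 mulrC divfK ?pnatr_eq0// addrC subrK.
by exists P => /=; rewrite !mulr1 in P1 P2.
Qed.

End SpectralSteps.

(** * The representing function of a mean *)

Section RankOne.
Context {R : realType} {H : hilbertType R}.
Implicit Types (A B T : bop H) (x y e : H) (c : R).

Lemma sa_inner A x y : sa A -> inner (A x) y = inner x (A y).
Proof.
move=> saA; rewrite !innerE; congr (_ +i* _); first exact: saA.
by rewrite saA linearZ.
Qed.

Lemma sa_innerxx A x : sa A -> inner (A x) x = (rip (A x) x)%:C.
Proof.
by move=> saA; rewrite innerE sa_rip_i.
Qed.

Lemma rip_ZZ (a : R[i]) x y :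
  rip (a *: x) (a *: y) = complex.Re (a * a^*) * rip x y.
Proof.
rewrite /rip linearZl_LR linearZr_LR /= mulrA; case: a => a b /=.
by case: (inner x y) => c d /=; ring.
Qed.

Lemma rank1_linear e : linear (fun x => inner x e *: e).
Proof.
by move=> a x y; rewrite linearDl linearZl_LR scalerDl scalerA.
Qed.

Lemma rank1_bounded e :
  exists c : R[i], forall x : H, `|inner x e *: e| <= c * `|x|.
Proof.
apply: (@bounded_nrm _ _ (fun x => inner x e *: e) (2 * nrm e ^+ 2)) => x.
rewrite innerE (complexE (Complex _ _)) scalerDl mulrC -scalerA /=.
have ne : nrm ('i *: e) = nrm e.
  by apply/eqP; rewrite -(eqrXn2 (ltn0Sn 1)) ?nrm_ge0// -!rip_nrm rip_i.
rewrite (le_trans (nrmD _ _))// !nrmZ ne.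
have h1 := rip_le x e; have := rip_le x ('i *: e); rewrite ne => h2.
have := nrm_ge0 e; nra.
Qed.

Definition rank1 e : bop H := BOp (@rank1_linear e) (rank1_bounded e).

Lemma rank1E e x : rank1 e x = inner x e *: e. Proof. by []. Qed.

Lemma innerxx x : inner x x = (rip x x)%:C.
Proof. by rewrite inner_normE nrmE -rmorphXn rip_nrm. Qed.

Lemma rank1_pos e : positive_op (rank1 e).
Proof.
move=> x; rewrite rank1E linearZl_LR /=; have := mulcJ_ge0 (inner x e).
by rewrite -[X in inner x e * X]innerC.
Qed.

Section Unit.
Variable e : H.
Hypothesis e1 : rip e e = 1.

Lemma rank1_unit : rank1 e e = e.
Proof. by rewrite rank1E innerxx e1 scale1r. Qed.

Lemma rank1_idem : rank1 e * rank1 e = rank1 e.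
Proof.
apply/bop_eqP => x; rewrite bopE (rank1E e x) (linearZ_LR (rank1 e)) /=.
by rewrite innerxx e1 scale1r.
Qed.

Lemma rank1_eigen A c : sa A -> A e = c%:C *: e ->
  GRing.comm (rank1 e) A /\ A * rank1 e = c *: rank1 e.
Proof.
move=> saA Ae; have AP : A * rank1 e = c *: rank1 e.
  by apply/bop_eqP => x; rewrite !bopE !rank1E (linearZ_LR A) /= Ae !scalerA mulrC.
split=> //; rewrite /GRing.comm AP; apply/bop_eqP => x.
rewrite !bopE !rank1E sa_inner// Ae linearZr_LR /= scalerA.
by congr ((_ * _) *: _); exact: conjc_real.
Qed.

Lemma rank1_compress A : sa A ->
  rank1 e * A * rank1 e = rip (A e) e *: rank1 e.
Proof.
move=> saA; apply/bop_eqP => x; rewrite !bopE !rank1E (linearZ_LR A) linearZl_LR.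
by rewrite /= sa_innerxx// scalerA mulrC.
Qed.

End Unit.

End RankOne.

Section OrthonormalPair.
Context {R : realType} {H : hilbertType R}.
Implicit Types (x y e : H).

Lemma normalize x : x != 0 ->
  exists2 c : R, c != 0 & rip (c%:C *: x) (c%:C *: x) = 1.
Proof.
move=> x0; have n0 : nrm x != 0 by rewrite nrm_eq0.
exists (nrm x)^-1; first by rewrite invr_eq0.
by rewrite !ripE rip_nrm; field.
Qed.

(** If [H] is spanned neither by the empty family nor by one vector, a Gram-Schmidt step produces
    the second vector. *)
Lemma orthonormal_pair : infinite_dimensional H ->
  exists e1 e2 : H, [/\ rip e1 e1 = 1, rip e2 e2 = 1 & inner e2 e1 = 0].
Proof.
move=> Hinf.
have [y y0] : exists y : H, y != 0.
  apply: contrapT => h; apply: Hinf; exists 0%N, (fun=> 0) => x.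
  exists (fun=> 0); rewrite big_ord0; apply/eqP/negP => /negP x0.
  by apply: h; exists x.
have [c _ e1] := normalize y0; set e := _ *: y in e1.
have [z z0] : exists z : H, z - inner z e *: e != 0.
  apply: contrapT => h; apply: Hinf; exists 1%N, (fun=> e) => x.
  exists (fun=> inner x e); rewrite big_ord1; apply/eqP/negP => /negP.
  by rewrite -subr_eq0 => x0; apply: h; exists x.
have [d _ e2] := normalize z0; exists e, (d%:C *: (z - inner z e *: e)).
split => //; rewrite linearZl_LR /= linearBl linearZl_LR /= innerxx e1 mulr1.
by rewrite subrr mulr0.
Qed.

End OrthonormalPair.

Section ScalarOperators.
Context {R : realType} {H : hilbertType R}.
Implicit Types (G : bop H) (x y e : H).

(** After subtracting [r0], [e0] lies in the kernel. If [y] and [e0 + y] are eigenvectors of the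
    difference, then either the eigenvalue at [e0 + y] is zero, or [y] is a multiple of [e0]; in
    both cases [y] is in the kernel as well. *)
Lemma scalar_eigen G e0 : rip e0 e0 = 1 ->
  (forall e, rip e e = 1 -> G e = (rip (G e) e)%:C *: e) ->
  G = (rip (G e0) e0)%:Op.
Proof.
move=> e01 hG; set r0 := rip (G e0) e0.
have eig y : exists r : R, G y = r%:C *: y.
  have [->|y0] := eqVneq y 0; first by exists 0; rewrite linear0 scaler0.
  have [c c0 /hG] := normalize y0; set r := rip _ _.
  rewrite linearZ /= => /(congr1 (fun z => c^-1%:C *: z)).
  rewrite !scalerA -!rmorphM -mulrA [r * c]mulrC mulrA mulVf//.
  by rewrite rmorph1 mul1r scale1r => ->; exists r.
pose G' := G - r0%:Op.
have G'e : G' e0 = 0 by rewrite /G' !bopE (hG _ e01) subrr.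
have eig' y : exists r : R, G' y = r%:C *: y.
  have [r ry] := eig y; exists (r - r0).
  by rewrite /G' !bopE ry rmorphB scalerBl.
apply: subr0_eq; rewrite -/G'; clearbody G'; apply/bop_eqP => y; rewrite bopE.
have [m my] := eig' y; have [v vy] := eig' (e0 + y).
rewrite linearD /= G'e add0r my in vy.
have [v0|v0] := eqVneq v 0; first by rewrite my vy v0 scale0r.
have e0y : e0 = (v^-1 * (m - v))%:C *: y.
  rewrite rmorphM -scalerA rmorphB scalerBl vy -scalerBr addrK.
  by rewrite scalerA -rmorphM mulVf// scale1r.
have c0 : v^-1 * (m - v) != 0.
  apply/eqP => c0; move: e01; rewrite e0y c0 scale0r rip0l => /eqP.
  by rewrite eq_sym oner_eq0.
have -> : y = (v^-1 * (m - v))^-1%:C *: e0.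
  by rewrite [in RHS]e0y scalerA -rmorphM mulVf// scale1r.
by rewrite linearZ /= G'e scaler0.
Qed.

Lemma le_scalarP (a b : R) (e : H) : rip e e = 1 ->
  le_op (a%:Op : bop H) b%:Op <-> a <= b.
Proof.
move=> e1; split=> [/(le_rip e)|ab].
  by rewrite !bopE !ripE e1 !mulr1.
by apply: le_opZl => //; exact: pos1.
Qed.

End ScalarOperators.

(** * Homogeneity of a mean and its localization at projections *)

Section OperatorMean.
Context {R : realType} {H : hilbertType R}.
Variable sigma : bop H -> bop H -> bop H.
Hypothesis hs : operator_mean sigma.
Implicit Types (A B C D P Q T : bop H) (x y e : H) (c t : R).

Lemma mean_conj_le C A B : positive_op A -> positive_op B -> positive_op C ->
  le_op (C * sigma A B * C) (sigma (C * A * C) (C * B * C)).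
Proof. by move=> pA pB pC; have := mean_transformer hs pA pB pC; rewrite -!mulrA. Qed.

(** The reverse inequality is the transformer inequality for the inverse [C'], conjugated by [C]. *)
Lemma mean_conj C C' A B : positive_op A -> positive_op B ->
  positive_op C -> positive_op C' -> C * C' = 1 -> C' * C = 1 ->
  C * sigma A B * C = sigma (C * A * C) (C * B * C).
Proof.
move=> pA pB pC pC' CC' C'C; apply: le_op_anti; first exact: mean_conj_le.
have K T : C' * (C * T * C) * C' = T.
  by rewrite !mulrA C'C mul1r -mulrA CC' mulr1.
have K' T : C * (C' * T * C') * C = T.
  by rewrite !mulrA CC' mul1r -mulrA C'C mulr1.
rewrite -[X in le_op X _]K'; apply: le_op_conj; first exact: pos_sa.
rewrite -[X in le_op _ (sigma X _)]K -[X in le_op _ (sigma _ X)]K.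
by apply: mean_conj_le => //; apply: pos_conj => //; exact: pos_sa.
Qed.

Lemma mean_scale c A B : 0 < c -> positive_op A -> positive_op B ->
  sigma (c *: A) (c *: B) = c *: sigma A B.
Proof.
move=> c0 pA pB; pose r := Num.sqrt c.
have r0 : 0 < r by rewrite sqrtr_gt0.
have rE T : r%:Op * T * r%:Op = c *: T.
  rewrite -bop_scaleAl mul1r -bop_scaleAr mulr1 scalerA -expr2 sqr_sqrtr//.
  exact: ltW.
rewrite -!rE; apply/esym; apply: (@mean_conj _ r^-1%:Op) => //.
- exact/pos_scalar/ltW.
- by apply/pos_scalar; rewrite invr_ge0 ltW.
- by rewrite -bop_scaleAl mul1r scalerA mulfV ?scale1r// gt_eqF.
- by rewrite -bop_scaleAl mul1r scalerA mulVf ?scale1r// gt_eqF.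
Qed.

Lemma rip_ext x y : (forall z, rip x z = rip y z) -> x = y.
Proof.
by move=> h; apply/subr0_eq/rip_xx_eq0; rewrite {1}ripBl h subrr.
Qed.

(** With [S = sigma A B] and [E = sigma (A * P) (B * P)], the transformer inequality gives
    [P S P <= E], and [A * P <= A] gives [E <= S]. So [S - P S P] is positive with zero compression
    to the range of [P], hence kills that range: [S P = P S P], and [P] commutes with [S].
    Compressing [P S P <= E <= S] by [P] gives the equality. *)
Lemma mean_proj P A B : positive_op P -> P * P = P ->
  GRing.comm P A -> GRing.comm P B -> positive_op A -> positive_op B ->
  GRing.comm P (sigma A B) /\
  P * sigma A B * P = P * sigma (A * P) (B * P) * P.
Proof.
move=> pP PP PA PB pA pB; have saP := pos_sa pP.
have p1P : positive_op (1 - P).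
  have -> : 1 - P = (1 - P) * (1 - P).
    by rewrite mulrBl mul1r mulrBr mulr1 PP subrr subr0.
  by apply: pos_sqr; apply: saB.
have restr T : positive_op T -> GRing.comm P T ->
    [/\ P * T * P = T * P, positive_op (T * P) & le_op (T * P) T].
  move=> pT PT; split; first by rewrite PT -mulrA PP.
    by apply: pos_mul => //; exact: commr_sym.
  apply/le_opE; rewrite -[X in X - _]mulr1 -mulrBr; apply: pos_mul => //.
  by apply: commrB; [exact: commr1|exact: commr_sym].
have [PAP pAP APA] := restr _ pA PA; have [PBP pBP BPB] := restr _ pB PB.
set S := sigma A B; set E := sigma (A * P) (B * P).
have saS : sa S by apply: pos_sa; exact: mean_positive.
have SE : le_op (P * S * P) E by rewrite /E -PAP -PBP; exact: mean_conj_le.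
have ES : le_op E S by exact: mean_monotone.
have SP : S * P = P * S * P.
  have /le_opE pD := le_op_trans SE ES.
  have PDP : P * (S - P * S * P) * P = 0.
    by rewrite mulrBr mulrBl !mulrA PP -(mulrA _ P P) PP subrr.
  apply/bop_eqP => x; apply/subr0_eq.
  have : (S - P * S * P) (P x) = 0.
    apply: pos_zero => //; rewrite -saP -!bop_mulE.
    by rewrite -[bop_fun _ x]/((P * (S - P * S * P) * P) x) PDP rip0l.
  by rewrite -bop_mulE mulrBl -(mulrA _ P P) PP.
split.
  rewrite /GRing.comm SP; apply/bop_eqP => x; apply: rip_ext => y.
  rewrite !bopE saP saS -(bop_mulE S P) SP !bopE.
  by rewrite saP saS saP.
apply: le_op_anti.
  by have := le_op_conj saP SE; rewrite !mulrA PP -(mulrA _ P P) PP.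
exact: le_op_conj.
Qed.

(** By [mean_proj], the part of the mean on the range of [P] depends on [B * P] alone, and this
    equals [t%:Op * P]. *)
Lemma mean_eigen P B t : positive_op P -> P * P = P -> GRing.comm P B ->
  positive_op B -> 0 <= t -> B * P = t *: P ->
  GRing.comm P (sigma 1 B) /\ sigma 1 B * P = P * sigma 1 t%:Op * P.
Proof.
move=> pP PP PB pB t0 BP; have p1 := @pos1 R H.
have [PS PSP] := mean_proj pP PP (commr1 P) PB p1 pB; split=> //.
have Pt : GRing.comm P t%:Op.
  by rewrite /GRing.comm -bop_scaleAr -bop_scaleAl mulr1 mul1r.
have [_ ->] := mean_proj pP PP (commr1 P) Pt p1 (pos_scalar t0).
rewrite mul1r in PSP.
by rewrite -bop_scaleAl !mul1r -BP -PSP PS -mulrA PP.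
Qed.

(** The projection onto any unit vector commutes with [1] and [t%:Op], hence with their mean; so
    every unit vector is an eigenvector of the mean. *)
Lemma mean_scalar : infinite_dimensional H ->
  exists f : R -> R, forall t, 0 <= t -> sigma 1 t%:Op = (f t)%:Op.
Proof.
move=> /orthonormal_pair[e0 [_ [e01 _ _]]].
exists (fun t => rip (sigma 1 t%:Op e0) e0) => t t0.
have pS := mean_positive hs pos1 (pos_scalar t0).
apply: scalar_eigen => // e e1.
have Pt : GRing.comm (rank1 e) t%:Op.
  by rewrite /GRing.comm -bop_scaleAr -bop_scaleAl mulr1 mul1r.
have [PS _] := mean_proj (rank1_pos e) (rank1_idem e1) (commr1 _) Pt pos1
  (pos_scalar t0).
have := congr1 (fun T : bop H => T e) PS; rewrite !bopE rank1_unit// => SE.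
by rewrite -{1}SE rank1E sa_innerxx//; exact: pos_sa.
Qed.

End OperatorMean.

(** * Monotonicity, concavity and rigidity of the representing function *)

Section RepresentingFunction.
Context {R : realType} {H : hilbertType R}.
Variable sigma : bop H -> bop H -> bop H.
Hypothesis hs : operator_mean sigma.
Hypothesis Hinf : infinite_dimensional H.
Variable f : R -> R.
Hypothesis fE : forall t, 0 <= t -> sigma 1 t%:Op = (f t)%:Op.
Implicit Types (A B C D P Q T : bop H) (x y e : H) (c r s t : R).

Let unit_vector : exists e : H, rip e e = 1.
Proof. by have [e [_ [e1 _ _]]] := orthonormal_pair Hinf; exists e. Qed.

Let le_scalar a b : le_op (a%:Op : bop H) b%:Op <-> a <= b.
Proof. by have [e e1] := unit_vector; exact: le_scalarP e1. Qed.

Lemma repr_ge0 t : 0 <= t -> 0 <= f t.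
Proof.
move=> t0; apply/le_scalar; rewrite scale0r -fE//; apply/le_op0.
exact: (mean_positive hs pos1 (pos_scalar t0)).
Qed.

Lemma mean_le1 A B : positive_op A -> le_op A B -> le_op (sigma 1 A) (sigma 1 B).
Proof.
move=> pA AB; have pB := pos_le pA AB.
by apply: mean_monotone => //; exact: pos1.
Qed.

Lemma repr_mono s t : 0 <= s -> s <= t -> f s <= f t.
Proof.
move=> s0 st; apply/le_scalar; rewrite -!fE ?(le_trans s0)//.
by apply: mean_le1; [exact: pos_scalar|exact/le_scalar].
Qed.

Lemma repr1 : f 1 = 1.
Proof.
have [e e1] := unit_vector.
have := fE ler01; rewrite scale1r (mean_normalized hs) => /bop_eqP/(_ e).
move=> /(congr1 (fun x => rip x e)); rewrite !bopE ripZl /= e1 mulr1 => <-.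
by [].
Qed.

(** Enlarge the first argument from [1] to [c], then use homogeneity. For scalars this says that
    [f t / t] does not increase. *)
Lemma mean1_dilate c B : 1 <= c -> positive_op B ->
  le_op (sigma 1 (c *: B)) (c *: sigma 1 B).
Proof.
move=> c1 pB; have c0 := lt_le_trans ltr01 c1; have p1 := @pos1 R H.
rewrite -mean_scale//; apply: mean_monotone => //; try exact/posZ/pB/ltW.
- exact/pos_scalar/ltW.
- by rewrite -[X in le_op X _]scale1r; exact/le_scalar.
Qed.

Lemma repr_dilate c t : 1 <= c -> 0 <= t -> f (c * t) <= c * f t.
Proof.
move=> c1 t0; have c0 := le_trans ler01 c1.
apply/le_scalar; rewrite -scalerA -!fE ?mulr_ge0//.
by rewrite -scalerA; apply: mean1_dilate => //; exact: pos_scalar.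
Qed.

Lemma repr_gt0 t : 0 < t -> 0 < f t.
Proof.
move=> t0; have [t1|t1] := leP 1 t.
  by apply: lt_le_trans (repr_mono ler01 t1); rewrite repr1.
have : 1 <= t^-1 by rewrite invr_ge1 ?ltW// unitf_gt0.
move=> /repr_dilate/(_ (ltW t0)); rewrite mulVf ?gt_eqF// repr1 => h.
rewrite lt_neqAle repr_ge0 ?ltW// andbT; apply/eqP => ft0.
by move: h; rewrite -ft0 mulr0 ler10.
Qed.

(** For [s <= t], [repr_dilate] bounds [f t] by [(t / s) f s], so the difference is at most
    [(t - s) f s / s], where [f s / s <= f b / a]. *)
Lemma repr_lipschitz a b s t : 0 < a -> a <= s <= b -> a <= t <= b ->
  `|f t - f s| <= f b / a * `|t - s|.
Proof.
move=> a0; wlog st : s t / s <= t.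
  move=> h sab tab; have [/h->//|/ltW ts] := leP s t.
  by rewrite distrC (distrC t); exact: h.
move=> /andP[sa sb] /andP[ta tb]; have s0 := lt_le_trans a0 sa.
rewrite !ger0_norm ?subr_ge0 ?repr_mono ?(ltW s0)//.
have h : f t <= t / s * f s.
  rewrite -{1}[t](divfK (lt0r_neq0 s0)); apply: repr_dilate; last exact: ltW.
  by rewrite ler_pdivlMr// mul1r.
apply: (@le_trans _ _ ((t - s) * (f s / s))).
  by rewrite lerBlDr (le_trans h)// le_eqVlt; apply/orP/or_introl/eqP; field; lra.
rewrite mulrC ler_wpM2r ?subr_ge0// ler_pM ?invr_ge0 ?repr_ge0 ?(ltW s0)//.
  by apply: repr_mono => //; exact: ltW.
by rewrite lef_pV2.
Qed.

Lemma mean1_eigenvector B t e : positive_op B -> 0 <= t -> rip e e = 1 ->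
  B e = t%:C *: e -> sigma 1 B e = (f t)%:C *: e.
Proof.
move=> pB t0 e1 Be; have [PB BP] := rank1_eigen (pos_sa pB) Be.
have [_] := mean_eigen hs (rank1_pos e) (rank1_idem e1) PB pB t0 BP.
rewrite fE// => /bop_eqP/(_ e); rewrite !bopE rank1_unit// linearZ => ->.
by rewrite -[LHS]/((f t)%:C *: rank1 e e) rank1_unit.
Qed.

(* Jensen's inequality follows from the transformer inequality for the rank-one
   projection onto [x]. *)
Lemma mean1_jensen B x : positive_op B -> rip x x = 1 ->
  rip (sigma 1 B x) x <= f (rip (B x) x).
Proof.
move=> pB x1; pose P := rank1 x; set b := rip (B x) x.
have b0 : 0 <= b by exact: pos_ge0.
have pP := rank1_pos x; have PP := rank1_idem x1; have p1 := @pos1 R H.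
have Px : P x = x by exact: rank1_unit.
have q S : rip ((P * S * P) x) x = rip (S x) x.
  by rewrite !bopE (pos_sa pP) !Px.
have Pb : GRing.comm P b%:Op.
  by rewrite /GRing.comm -bop_scaleAr -bop_scaleAl mulr1 mul1r.
have [_ PSP] := mean_proj hs pP PP (commr1 P) Pb p1 (pos_scalar b0).
have := le_rip x (mean_conj_le hs p1 pB pP).
rewrite q (rank1_compress x (pos_sa pB)) -/b mulr1 PP => /le_trans; apply.
rewrite mul1r -bop_scaleAl mul1r fE// in PSP.
by rewrite -q -/P -PSP q !bopE ripZl x1 mulr1.
Qed.

Lemma rip_orthonormal e1 e2 (a b c d : R) :
  rip e1 e1 = 1 -> rip e2 e2 = 1 -> rip e1 e2 = 0 ->
  rip (a%:C *: e1 + b%:C *: e2) (c%:C *: e1 + d%:C *: e2) = a * c + b * d.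
Proof.
move=> e11 e22 e12; rewrite !ripE e11 e22 (ripC e2) e12.
by rewrite !(mulr0, mulr1, addr0, add0r).
Qed.

Lemma two_eigenvectors s t : 0 <= s -> 0 <= t ->
  exists B e1 e2,
    [/\ positive_op B, B e1 = s%:C *: e1 & B e2 = t%:C *: e2] /\
    [/\ rip e1 e1 = 1, rip e2 e2 = 1 & rip e1 e2 = 0].
Proof.
move=> s0 t0; have [e1 [e2 [e11 e22 e21]]] := orthonormal_pair Hinf.
exists (s *: rank1 e1 + t *: (1 - rank1 e1)), e1, e2; split; last first.
  by split=> //; rewrite ripC /rip e21.
have pP : positive_op (1 - rank1 e1).
  have -> : 1 - rank1 e1 = (1 - rank1 e1) * (1 - rank1 e1).
    by rewrite mulrBl mul1r mulrBr mulr1 rank1_idem// subrr subr0.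
  by apply/pos_sqr/saB; [exact: sa1|exact/pos_sa/rank1_pos].
split; first by apply: posD; apply: posZ => //; exact: rank1_pos.
  by rewrite !bopE rank1_unit// subrr scaler0 addr0.
by rewrite !bopE !rank1E e21 scale0r subr0 scaler0 add0r.
Qed.

(** Jensen's inequality for an operator with eigenvalues [s] and [t], at a unit vector of spectral
    weights [r] and [1 - r]. *)
Lemma repr_concave r s t : 0 <= s -> 0 <= t -> 0 <= r <= 1 ->
  r * f s + (1 - r) * f t <= f (r * s + (1 - r) * t).
Proof.
move=> s0 t0 /andP[r0 r1]; have r1' : 0 <= 1 - r by rewrite subr_ge0.
have [B [e1 [e2 [[pB Be1 Be2] [e11 e22 e12]]]]] := two_eigenvectors s0 t0.
pose x := (Num.sqrt r)%:C *: e1 + (Num.sqrt (1 - r))%:C *: e2.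
have eig (S : bop H) a b : S e1 = a%:C *: e1 -> S e2 = b%:C *: e2 ->
    rip (S x) x = r * a + (1 - r) * b.
  move=> Se1 Se2; rewrite linearD !linearZ /= Se1 Se2 !scalerA -!rmorphM.
  rewrite rip_orthonormal// !(mulrAC _ _ (Num.sqrt _)) -!expr2.
  by rewrite !sqr_sqrtr.
have x1 : rip x x = 1.
  by rewrite rip_orthonormal// -!expr2 !sqr_sqrtr// subrKC.
have Bx := eig _ _ _ Be1 Be2.
have Sx := eig _ _ _ (mean1_eigenvector pB s0 e11 Be1)
  (mean1_eigenvector pB t0 e22 Be2).
by rewrite -Sx -Bx; exact: mean1_jensen.
Qed.

(** Cauchy-Schwarz for the form of [B], at a multiple of [w] and at [z], gives
    [|<z, v>|^2 <= <v, w> <B z, z>]. As [w] plays the role of [B^-1 v], the hypothesis is the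
    criterion [s <v, B^-1 v> <= 1]. *)
Lemma rank1_le B v w s : positive_op B -> rip v v = 1 -> B w = v -> 0 <= s ->
  s * rip v w <= 1 -> le_op (s *: rank1 v) B.
Proof.
move=> pB v1 Bw s0 sk; have pv := rank1_pos v.
apply: le_opI => [||z]; [exact/saZ/pos_sa|exact: pos_sa|].
rewrite bopE ripZl; set k := rip v w in sk; pose a := inner z v.
have m1 : rip (rank1 v z) z = complex.Re (a * a^*).
  rewrite -{1}rank1_idem// bopE (pos_sa pv) rank1E rip_ZZ v1 mulr1.
  by [].
have := pos_CS (a *: w) z pB; rewrite linearZ /= Bw -/(rank1 v z) m1.
rewrite rip_ZZ -/k; have := pos_ge0 z pB; have := pos_ge0 z pv; rewrite m1.
set m := complex.Re _; set b := rip (B z) z => m0 b0.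
move: m0; rewrite le_eqVlt => /predU1P[<- _|m0 mb]; first by rewrite mulr0.
have {}mb : m <= k * b by move: mb; rewrite expr2 -mulrA ler_pM2l.
by apply: (@le_trans _ _ (s * (k * b))); [rewrite ler_wpM2l|rewrite mulrA ler_piMl].
Qed.

(* An operator monotone function cannot become constant: with [B] having the
   eigenvalues [r < t], the rank-one operator [A] with eigenvalue [s < t] along
   a vector slightly tilted from the [t]-eigenvector towards the [r]-eigenvector
   satisfies [A <= B], hence [f s <= l f r + (1 - l) f t] for some
   [l > 0]. *)
Lemma repr_flat_left r s t : 0 < r -> r < s -> s < t -> f s = f t -> f s <= f r.
Proof.
move=> r0 rs st fst; have s0 := lt_trans r0 rs; have t0 := lt_trans s0 st.
have [B [e1 [e2 [[pB Be1 Be2] [e11 e22 e12]]]]] :=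
  two_eigenvectors (ltW r0) (ltW t0).
(* [l] solves [s * l / r + s / t = 1]; this makes [s * rip v w] equal to [1 - l * s / t], which is
   at most 1. *)
pose l := r * (t - s) / (t * s).
have l0 : 0 < l by rewrite divr_gt0 ?mulr_gt0 ?subr_gt0.
have l1 : l <= 1 by rewrite ler_pdivrMr ?mulr_gt0// mul1r; nra.
have l1' : 0 <= 1 - l by rewrite subr_ge0.
pose p := Num.sqrt l; pose q := Num.sqrt (1 - l).
have pp : p * p = l by rewrite -expr2 sqr_sqrtr// ltW.
have qq : q * q = 1 - l by rewrite -expr2 sqr_sqrtr.
pose v := p%:C *: e1 + q%:C *: e2.
pose w := (p / r)%:C *: e1 + (q / t)%:C *: e2.
have v1 : rip v v = 1 by rewrite rip_orthonormal// pp qq subrKC.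
have Bw : B w = v.
  rewrite /w linearD !linearZ /= Be1 Be2 !scalerA -!rmorphM.
  by rewrite !divfK ?gt_eqF.
have k1 : s * rip v w <= 1.
  rewrite rip_orthonormal// !mulrA pp qq.
  have -> : s * (l / r + (1 - l) / t) = 1 - l * s / t.
    by rewrite /l; field; rewrite !gt_eqF.
  by rewrite gerBl; exact: (divr_ge0 (mulr_ge0 (ltW l0) (ltW s0)) (ltW t0)).
have AB := rank1_le pB v1 Bw (ltW s0) k1.
have pA : positive_op (s *: rank1 v) by apply: posZ (ltW s0) (rank1_pos v).
have Av : (s *: rank1 v) v = s%:C *: v by rewrite bopE rank1_unit.
have := le_rip v (mean_le1 pA AB).
rewrite (mean1_eigenvector pA (ltW s0) v1 Av) ripZl v1 mulr1.
rewrite {1}/v linearD !linearZ /= (mean1_eigenvector pB (ltW r0) e11 Be1).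
rewrite (mean1_eigenvector pB (ltW t0) e22 Be2) !scalerA -!rmorphM.
rewrite rip_orthonormal// !(mulrAC _ _ p) !(mulrAC _ _ q) pp qq -fst; nra.
Qed.

(** To the left of [s] this is [repr_flat_left]. To the right of [t], concavity applies because [t]
    lies strictly between [s] and [r]. The constant is then the value at 1. *)
Lemma repr_flat s t : 0 < s -> s < t -> f s = f t -> forall r, 0 < r -> f r = 1.
Proof.
move=> s0 st fst.
suff h r : 0 < r -> f r = f s by move=> r r0; rewrite h// -repr1 h.
move=> r0; have [rs|sr] := ltP r s.
  apply/eqP; rewrite eq_le repr_mono ?(ltW r0) ?(ltW rs)//=.
  exact: repr_flat_left rs st fst.
apply/eqP; rewrite eq_le [X in _ && X]repr_mono ?(ltW s0)// andbT.
have [rt|tr] := leP r t; first by rewrite fst repr_mono// ltW.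
pose l := (r - t) / (r - s).
have rs : 0 < r - s by rewrite subr_gt0 (lt_trans st).
have l0 : 0 <= l by apply: divr_ge0; [rewrite subr_ge0 ltW|exact: ltW].
have l1 : l < 1 by rewrite ltr_pdivrMr// mul1r ltrD2l ltrN2.
have l01 : 0 <= l <= 1 by rewrite l0 ltW.
have := repr_concave (ltW s0) (ltW r0) l01.
have -> : l * s + (1 - l) * r = t by rewrite /l; field; rewrite gt_eqF.
rewrite -fst; nra.
Qed.

(** Both [b] and [s + d] are convex combinations of [s] and [b + d], with exchanged weights; the two
    concavity inequalities are added. *)
Lemma repr_increment s b d : 0 <= s -> s <= b -> 0 < d ->
  f (b + d) - f b <= f (s + d) - f s.
Proof.
move=> s0 sb d0; have b0 := le_trans s0 sb.
pose r := d / (b - s + d).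
have k0 : 0 < b - s + d by rewrite ltr_wpDl ?subr_ge0.
have k0' : b - s + d != 0 by rewrite gt_eqF.
have r01 : 0 <= r <= 1.
  by rewrite divr_ge0 ?(ltW d0) ?(ltW k0)// ler_pdivrMr// mul1r lerDr subr_ge0.
have r01' : 0 <= 1 - r <= 1 by case/andP: r01; lra.
have bd0 : 0 <= b + d by rewrite addr_ge0// ltW.
have := repr_concave s0 bd0 r01; have := repr_concave s0 bd0 r01'.
have -> : r * s + (1 - r) * (b + d) = b by rewrite /r; field.
have -> : (1 - r) * s + (1 - (1 - r)) * (b + d) = s + d by rewrite /r; field.
lra.
Qed.

End RepresentingFunction.

(** * Relative bounds between positive invertible operators *)

Section RelativeBounds.
Context {R : realType} {H : hilbertType R}.
Implicit Types (A B C D P Q S T : bop H) (x y e : H) (a b c d : R).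

Lemma archimedean_quotient c (e : R) : 0 < e -> exists2 n, (0 < n)%N & c / n%:R <= e.
Proof.
move=> e0; have [c0|/ltW c0] := leP c 0.
  by exists 1%N => //; rewrite divr1 (le_trans c0)// ltW.
exists (Num.bound (c / e)).+1 => //.
have := archi_boundP (divr_ge0 c0 (ltW e0)).
rewrite ltr_pdivrMr// => h; rewrite ler_pdivrMr ?ltr0n// mulrC ltW//.
by rewrite (lt_le_trans h)// ler_pM2r// ler_nat.
Qed.

Lemma posinv_sqrt A : posinv_op A -> exists S S',
  [/\ positive_op S, positive_op S', S * S = A, S * S' = 1 & S' * S = 1].
Proof.
move=> iA; have [S [pS SS bS]] := sqrt_exists (posinv_pos iA).
have [B [AB BA pB]] := posinv_inverse iA.
have SB1 : S * (S * B) = 1 by rewrite mulrA SS.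
have BS1 : B * S * S = 1 by rewrite -mulrA SS.
have SB : S * B = B * S by rewrite -[LHS]mul1r -BS1 -mulrA SB1 mulr1.
exists S, (S * B); split => //; first exact: pos_mul.
by rewrite SB.
Qed.

Lemma le_op_scalar_bounds A B a b : 0 <= a -> 0 < b ->
  le_op a%:Op A -> le_op B b%:Op -> le_op ((a / b) *: B) A.
Proof.
move=> a0 b0 aA Bb; apply: le_op_trans aA.
have -> : a%:Op = (a / b) *: b%:Op :> bop H by rewrite scalerA divfK// gt_eqF.
by apply: le_opZ => //; rewrite divr_ge0// ltW.
Qed.

Lemma le_op_scalar_bounds_r A B a b : 0 < a -> 0 <= b ->
  le_op a%:Op A -> le_op B b%:Op -> le_op B ((b / a) *: A).
Proof.
move=> a0 b0 aA Bb; apply: le_op_trans Bb _.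
have -> : b%:Op = (b / a) *: a%:Op :> bop H by rewrite scalerA divfK// gt_eqF.
by apply: le_opZ => //; rewrite divr_ge0// ltW.
Qed.

Lemma posinv_bounds A : posinv_op A ->
  exists2 c, 0 < c & exists2 d, 0 < d & le_op c%:Op A /\ le_op A d%:Op.
Proof.
move=> /posinv_opP[pA [c c0 cA]]; have [d d0 [_ Ad]] := sa_le (pos_sa pA).
by exists c => //; exists d.
Qed.

Lemma posinv_relative A B : posinv_op A -> posinv_op B ->
  exists2 m, 0 < m & exists2 b, m <= b & le_op (m *: A) B /\ le_op B (b *: A).
Proof.
move=> /posinv_bounds[a a0 [a' a'0 [aA Aa']]].
move=> /posinv_bounds[b b0 [b' b'0 [bB Bb']]].
exists (b / a'); first exact: divr_gt0.
(* The maximum gives [m <= b] outright, without testing the operator bounds on a nonzero vector. *)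
exists (Num.max (b / a') (b' / a)); first by rewrite le_max lexx.
split; first by apply: le_op_scalar_bounds bB Aa' => //; exact: ltW.
have pA : positive_op A by apply: pos_le aA; exact/pos_scalar/ltW.
apply: (@le_op_trans _ _ ((b' / a) *: A)).
  by apply: le_op_scalar_bounds_r => //; exact: ltW.
by apply: le_opZl pA; rewrite le_max lexx orbT.
Qed.

Lemma adj_rip S S' x y : is_adjoint S S' -> rip (S x) y = rip x (S' y).
Proof. by move=> adj; rewrite /rip adj. Qed.

Lemma posinv_adj A S S' : posinv_op A -> bop_invertible S -> is_adjoint S S' ->
  posinv_op (S' * A * S).
Proof.
move=> /posinv_opP[pA [a a0 aA]] [V [_ VS]] adj.
have pS : positive_op (S' * S) by rewrite -[S']mulr1; apply: pos_adj pos1.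
have [v v0 Vv] := bop_bound V; have v2 : 0 < v ^+ 2 by rewrite exprn_gt0.
have low : le_op (v ^+ 2)^-1%:Op (S' * S).
  apply: le_opI => [||x]; [exact/saZ|exact: pos_sa|].
  rewrite !bopE ripZl ler_pdivrMl// [rip (S' _) _]ripC -(adj_rip _ _ adj).
  rewrite !rip_nrm -exprMn ler_sqr ?nnegrE ?mulr_ge0 ?nrm_ge0 ?(ltW v0)//.
  by rewrite -{1}[x]/((1 : bop H) x) -[1]VS; exact: Vv.
apply: (@posinv_le _ _ (a / v ^+ 2)%:Op).
  by apply: posinv_scalar; exact: divr_gt0.
apply: (@le_op_trans _ _ (a *: (S' * S))).
  by rewrite -scalerA; apply: le_opZ low; exact: ltW.
by have := le_op_adj adj aA; rewrite -bop_scaleAr mulr1 -bop_scaleAl.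
Qed.

Lemma posinvZ c A : 0 < c -> posinv_op A -> posinv_op (c *: A).
Proof.
move=> c0 /posinv_opP[pA [d d0 dA]]; apply/posinv_opP; split.
  by apply: posZ => //; exact: ltW.
exists (c * d); first exact: mulr_gt0.
by rewrite -scalerA; apply: le_opZ dA; exact: ltW.
Qed.

(** [S' * B * S'] is [A^(-1/2) B A^(-1/2)]: conjugation turns bounds relative to [A] into scalar
    bounds. *)
Lemma conj_bounds A B S S' m b : S * S = A -> S * S' = 1 -> S' * S = 1 ->
  sa S' -> le_op (m *: A) B -> le_op B (b *: A) ->
  le_op m%:Op (S' * B * S') /\ le_op (S' * B * S') b%:Op.
Proof.
move=> SS SS' S'S saS'.
have E c : c%:Op = S' * (c *: A) * S'.
  rewrite -bop_scaleAr -bop_scaleAl -SS !mulrA S'S mul1r SS'.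
  by [].
by rewrite !E => mB Bb; split; exact: le_op_conj.
Qed.

Lemma shift_cvg A : sot_cvg (fun k => A + k.+1%:R^-1%:Op) A.
Proof.
rewrite -[X in sot_cvg _ X]addr0; apply: sotD; first exact: sot_cst.
move=> x; apply/hcvgP; have h : (fun k => nrm (k.+1%:R^-1%:Op x - (0 : bop H) x)) =
    (fun k => k.+1%:R^-1 * nrm x).
  by apply/funext => k; rewrite !bopE subr0 nrmZ ger0_norm// invr_ge0.
rewrite h -[X in _ --> X](mul0r (nrm x)); apply: cvgMl.
exact: cvg_harmonic.
Qed.

(** Invertible operators thus approach a positive one from above, so decreasing continuity extends
    identities from invertible to positive arguments. *)
Lemma shift_decreases A : decreases_to (fun k => A + k.+1%:R^-1%:Op) A.
Proof.
split=> [k l kl|]; last exact: shift_cvg.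
apply: le_opD => //; apply: le_opZl; last exact: pos1.
by rewrite lef_pV2 ?posrE ?ltr0n// ler_nat.
Qed.

Lemma shift_posinv A k : positive_op A -> posinv_op (A + k.+1%:R^-1%:Op).
Proof.
move=> pA; apply: (@posinv_le _ _ k.+1%:R^-1%:Op).
  by apply: posinv_scalar; rewrite invr_gt0 ltr0n.
by apply/le_opE; rewrite addrK.
Qed.

End RelativeBounds.

(** * The uniform gap and the strict contraction estimate *)

Section Contraction.
Context {R : realType} {H : hilbertType R}.
Variable sigma : bop H -> bop H -> bop H.
Hypothesis hs : operator_mean sigma.
Hypothesis Hinf : infinite_dimensional H.
Variable f : R -> R.
Hypothesis fE : forall t, 0 <= t -> sigma 1 t%:Op = (f t)%:Op.
Implicit Types (A B C D P Q S T : bop H) (x y : H) (a b c d r s t : R).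

(** The Kubo-Ando formula with [sigma 1] in the role of [f], from invariance under conjugation by
    the invertible square root of [A]. *)
Lemma mean_formula A B S S' : positive_op S -> positive_op S' ->
  S * S = A -> S * S' = 1 -> S' * S = 1 -> positive_op B ->
  sigma A B = S * sigma 1 (S' * B * S') * S.
Proof.
move=> pS pS' SS SS' S'S pB; have pT := pos_conj (pos_sa pS') pB; have p1 := @pos1 R H.
rewrite (mean_conj hs p1 pT pS pS' SS' S'S) mulr1 SS !mulrA SS' mul1r.
by rewrite -mulrA S'S mulr1.
Qed.

Lemma mean1_bounds T m b : 0 <= m -> le_op m%:Op T -> le_op T b%:Op ->
  le_op (f m)%:Op (sigma 1 T) /\ le_op (sigma 1 T) (f b)%:Op.
Proof.
move=> m0 mT Tb; have pT := pos_le (pos_scalar m0) mT.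
have [e [_ [e1 _ _]]] := orthonormal_pair Hinf.
have b0 : 0 <= b.
  have := le_rip e Tb; rewrite !bopE ripZl e1 mulr1; apply: le_trans.
  exact: pos_ge0.
rewrite -!fE//; split; apply: mean_le1 => //; exact: pos_scalar.
Qed.

(** If [f] is 1, the bounds [f m] and [f b] squeeze [sigma 1 T] to [1], which settles invertible
    arguments; the others follow by decreasing continuity. *)
Lemma repr_const_left_trivial : (forall t, 0 < t -> f t = 1) -> left_trivial sigma.
Proof.
move=> f1; have inv A B : posinv_op A -> posinv_op B -> sigma A B = A.
  move=> iA iB; have [S [S' [pS pS' SS SS' S'S]]] := posinv_sqrt iA.
  have [m m0 [b mb [mB Bb]]] := posinv_relative iA iB.
  have b0 := lt_le_trans m0 mb.
  have [mT Tb] := conj_bounds SS SS' S'S (pos_sa pS') mB Bb.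
  rewrite (mean_formula pS pS' SS SS' S'S (posinv_pos iB)).
  have [] := mean1_bounds (ltW m0) mT Tb; rewrite !f1// scale1r => h1 h2.
  by rewrite (le_op_anti h2 h1) mulr1.
move=> A B pA pB.
have [_ h] := mean_continuous hs (fun k => posinv_pos (shift_posinv k pA))
  (fun k => posinv_pos (shift_posinv k pB)) pA pB
  (shift_decreases A) (shift_decreases B).
apply: (sot_unique h).
have -> : (fun k => sigma (A + k.+1%:R^-1%:Op) (B + k.+1%:R^-1%:Op)) =
    (fun k => A + k.+1%:R^-1%:Op).
  by apply/funext => k; apply: inv; exact: shift_posinv.
exact: shift_cvg.
Qed.

Lemma repr_strict : ~ left_trivial sigma -> forall s t, 0 < s -> s < t -> f s < f t.
Proof.
move=> nl s t s0 st; rewrite lt_neqAle (repr_mono hs Hinf fE (ltW s0) (ltW st)) andbT.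
apply/eqP => fst; apply/nl/repr_const_left_trivial => r.
exact: (repr_flat hs Hinf fE s0 st fst).
Qed.

(** A functional calculus for step operators: [mean_eigen] evaluates the mean on each [P i], and the
    pieces are summed over the resolution of the identity. *)
Lemma mean1_steps n (P : 'I_n -> bop H) (t : 'I_n -> R) :
  orthogonal_projections P -> \sum_(i < n) P i = 1 -> (forall i, 0 <= t i) ->
  sigma 1 (\sum_(i < n) t i *: P i) = \sum_(i < n) f (t i) *: P i.
Proof.
move=> oP sP t0; have [pP PP] := oP.
rewrite -[LHS]mulr1 -[X in _ * X = _]sP mulr_sumr; apply: eq_bigr => i _.
have pB : positive_op (\sum_(i < n) t i *: P i).
  by apply: pos_sum => j; apply: posZ.
have PB : GRing.comm (P i) (\sum_(i < n) t i *: P i).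
  by rewrite /GRing.comm orthogonal_mull// orthogonal_mulr.
have PPi : P i * P i = P i by rewrite PP eqxx.
have [_ ->] := mean_eigen hs (pP i) PPi PB pB (t0 i) (orthogonal_mulr _ _ oP).
by rewrite fE// -bop_scaleAr -bop_scaleAl mulr1 PPi.
Qed.

Lemma sum_projectionsD n (P : 'I_n -> bop H) (t : 'I_n -> R) c :
  \sum_(i < n) P i = 1 ->
  \sum_(i < n) t i *: P i + c%:Op = \sum_(i < n) (t i + c) *: P i.
Proof.
by move=> <-; rewrite scaler_sumr -big_split /=; apply: eq_bigr => i _; rewrite scalerDl.
Qed.

Lemma step_range a b n (i : 'I_n) : a <= b ->
  a <= a + i%:R * ((b - a) / n%:R) <= b.
Proof.
move=> ab; have n0 : 0 < n%:R :> R by rewrite ltr0n; case: n i => [[]|].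
rewrite lerDl mulr_ge0 ?divr_ge0 ?subr_ge0 ?ler0n//=.
rewrite -lerBrDl mulrA ler_pdivrMr// mulrC ler_wpM2l ?subr_ge0//.
by rewrite ler_nat ltnW.
Qed.

(** For a step operator below [T], the mean acts slice by slice, and the gain is an increment of [f]
    at some point of [[0, b]]. By [repr_increment] it is at least the increment at the top, so [e]
    does not depend on [T]. *)
Lemma mean1_gap b d : ~ left_trivial sigma -> 0 <= b -> 0 < d ->
  exists2 e, 0 < e & forall T, positive_op T -> le_op T b%:Op ->
    le_op (sigma 1 T + e%:Op) (sigma 1 (T + d%:Op)).
Proof.
(* One half of [d] pays for replacing [T] by a step operator of mesh at most [h]; the other half
   produces the gain. *)
move=> nl b0 d0; have [h h0 hh] : exists2 h, 0 < h & d = h + h.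
  by exists (d / 2); [rewrite divr_gt0|field].
have bh0 : 0 < b + h by rewrite ltr_wpDl.
exists (f (b + h + h) - f (b + h)).
  by rewrite subr_gt0 repr_strict// ltrDl.
move=> T pT Tb; have [n n0 bn] := archimedean_quotient b h0.
have T0 : le_op 0%:Op T by rewrite scale0r; apply/le_op0.
have [P /= [oP sP ST TS]] := spectral_steps b0 n0 (pos_sa pT) T0 Tb.
set t := fun i : 'I_n => 0 + i%:R * ((b - 0) / n%:R).
rewrite -/(\sum_(i < n) t i *: P i) in ST TS.
have tb i : 0 <= t i <= b by exact: step_range.
have t0 i : 0 <= t i by case/andP: (tb i).
have pS : positive_op (\sum_(i < n) t i *: P i).
  by apply: pos_sum => i; apply: posZ => //; case: oP.
have ph : positive_op (h%:Op : bop H) by exact/pos_scalar/ltW.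
apply: (@le_op_trans _ _ (sigma 1 (\sum_(i < n) t i *: P i + h%:Op)
   + (f (b + h + h) - f (b + h))%:Op)).
  apply: le_opD => //; apply: (mean_le1 hs) => //.
  apply: le_op_trans TS _; apply: le_opD => //.
  by apply: le_opZl pos1; rewrite subr0.
apply: (@le_op_trans _ _ (sigma 1 (\sum_(i < n) t i *: P i + d%:Op))); last first.
  apply: (mean_le1 hs); last exact: le_opD.
  by apply: posD => //; exact/pos_scalar/ltW.
rewrite !sum_projectionsD// !mean1_steps//; last 2 first.
- by move=> i; rewrite addr_ge0// ltW.
- by move=> i; rewrite addr_ge0// ltW.
rewrite sum_projectionsD//; apply: le_op_sum => i.
apply: le_opZl; last by case: oP.
have th : 0 <= t i + h by rewrite addr_ge0// ltW.
have := repr_increment hs Hinf fE th _ h0 (b := b + h).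
rewrite lerD2r => /(_ (proj2 (andP (tb i)))).
by rewrite hh (addrA (t i)); lra.
Qed.

(** Conjugation reduces the claim to [T] with [m <= T <= b]. Dividing [T] by [c] lowers it by at
    least [m * (1 - c^-1)], so [mean1_gap] yields an additive loss [e]; the bound [sigma 1 T <= f b]
    makes this loss a factor. *)
Lemma mean_contract X A c : ~ left_trivial sigma -> posinv_op X -> posinv_op A ->
  1 < c -> exists b, 0 < b < 1 /\
    le_op (sigma X (c^-1 *: A)) (b *: sigma X A).
Proof.
move=> nl iX iA c1; have [S [S' [pS pS' SS SS' S'S]]] := posinv_sqrt iX.
have c0 := lt_trans ltr01 c1.
have [m m0 [b mb [mB Bb]]] := posinv_relative iX iA.
have b0 := lt_le_trans m0 mb.
have [mT Tb] := conj_bounds SS SS' S'S (pos_sa pS') mB Bb.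
have pA := posinv_pos iA; have icA : 0 <= c^-1 by rewrite invr_ge0 ltW.
rewrite !(mean_formula pS pS' SS SS' S'S)//; last exact: posZ.
rewrite -bop_scaleAr -bop_scaleAl; set T := S' * A * S' in mT Tb *.
have pT : positive_op T by apply: pos_le mT; exact/pos_scalar/ltW.
have d0 : 0 < m * (1 - c^-1) by rewrite mulr_gt0// subr_gt0 invf_lt1.
have [e e0 gap] := mean1_gap nl (ltW b0) d0.
have cT : le_op (c^-1 *: T) b%:Op.
  apply: le_op_trans Tb; rewrite -[X in le_op _ X]scale1r.
  by apply: le_opZl => //; rewrite invf_le1// ltW.
have := gap _ (posZ icA pT) cT.
have TT : le_op (c^-1 *: T + (m * (1 - c^-1))%:Op) T.
  apply/le_opE; rewrite opprD addrA.
  have -> : T - c^-1 *: T = (1 - c^-1) *: T by rewrite scalerBl scale1r.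
  apply/le_opE; rewrite mulrC -scalerA; apply: le_opZ mT.
  by rewrite subr_ge0 invf_le1// ltW.
move=> /le_op_trans/(_ (mean_le1 hs _ TT)) h.
have {}h : le_op (sigma 1 (c^-1 *: T) + e%:Op) (sigma 1 T).
  apply: h; apply: posD; first exact: posZ.
  exact/pos_scalar/ltW.
have fb0 : 0 < f b by exact: (repr_gt0 hs Hinf fE).
have [_ Tfb] := mean1_bounds (ltW m0) mT Tb.
(* [k * f b <= e] is what the estimate requires; the extra [e] in the denominator keeps [k] below
   1. *)
pose k := e / (f b + e).
have fbe : 0 < f b + e by exact: addr_gt0.
have k0 : 0 < k by exact: divr_gt0.
have k1 : k < 1 by rewrite ltr_pdivrMr// mul1r ltrDr.
exists (1 - k); split; first by apply/andP; lra.
rewrite bop_scaleAl bop_scaleAr; apply: le_op_conj; first exact: pos_sa.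
rewrite scalerBl scale1r; apply/le_opE; rewrite addrAC; apply/le_opE.
apply: (@le_op_trans _ _ e%:Op); last first.
  by apply/le_opE; rewrite -addrA -opprD; apply/le_opE.
apply: (@le_op_trans _ _ (k *: (f b)%:Op)).
  by apply: le_opZ Tfb; exact: ltW.
rewrite scalerA; apply: le_opZl pos1.
by rewrite /k mulrAC ler_pdivrMr// ler_pM2l// lerDl ltW.
Qed.

End Contraction.

(** * Joint continuity and congruence invariance *)

Section ApproximateEigenvectors.
Context {R : realType} {H : hilbertType R}.
Variable sigma : bop H -> bop H -> bop H.
Hypothesis hs : operator_mean sigma.
Hypothesis Hinf : infinite_dimensional H.
Variable f : R -> R.
Hypothesis fE : forall t, 0 <= t -> sigma 1 t%:Op = (f t)%:Op.
Implicit Types (A B C D P Q S T V : bop H) (x y : H) (a b c d m r s t : R).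

Lemma nrm_projections n (P : 'I_n -> bop H) (u : 'I_n -> R) y :
  orthogonal_projections P ->
  nrm ((\sum_(i < n) u i *: P i) y) ^+ 2 =
    \sum_(i < n) u i ^+ 2 * nrm (P i y) ^+ 2.
Proof.
move=> oP; have [pP PP] := oP.
have saP i : sa (P i) by exact: pos_sa.
have saU : sa (\sum_(i < n) u i *: P i) by apply: sa_sum => i; exact: saZ.
rewrite -rip_nrm saU -bop_mulE mulr_sumr bop_sumE rip_sumr.
apply: eq_bigr => i _; rewrite -bop_scaleAr orthogonal_mulr// scalerA.
rewrite bopE ripZr -expr2 -rip_nrm saP -bop_mulE PP eqxx.
by [].
Qed.

(** For a step operator both sides are orthogonal sums over the slices, and the claim is the scalar
    Lipschitz bound in each slice. The general case follows by approximation. *)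
Lemma mean1_lipschitz m b T t y : 0 < m -> m <= t <= b ->
  le_op m%:Op T -> le_op T b%:Op ->
  nrm (sigma 1 T y - (f t)%:C *: y) <= f b / m * nrm (T y - t%:C *: y).
Proof.
move=> m0 mtb mT Tb; have mb : m <= b by case/andP: mtb; exact: le_trans.
have pT : positive_op T by apply: pos_le mT; exact/pos_scalar/ltW.
have b0 : 0 < b by exact: lt_le_trans mb.
have fb0 : 0 < f b by exact: (repr_gt0 hs Hinf fE).
pose L := f b / m; have L0 : 0 < L by exact: divr_gt0.
apply/ler_addgt0Pr => e e0.
(* Passing from [T] to [S] costs [L * d * nrm y] twice, once inside the mean and once in the
   residual. *)
have [n n0 ne] := archimedean_quotient ((b - m) * (2 * L * nrm y)) e0.
have [P /= [oP sP ST TS]] := spectral_steps mb n0 (pos_sa pT) mT Tb.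
pose d := (b - m) / n%:R.
have d0 : 0 <= d by rewrite divr_ge0 ?subr_ge0 ?ler0n.
rewrite -/d in ST TS; pose u := fun i : 'I_n => m + i%:R * d.
pose S := \sum_(i < n) u i *: P i; rewrite -/S in ST TS.
have ub i : m <= u i <= b by exact: step_range.
have um i : m <= u i by case/andP: (ub i).
have mS : le_op m%:Op S.
  rewrite -sP scaler_sumr; apply: le_op_sum => i.
  by apply: le_opZl => //; case: oP.
have pS : positive_op S by apply: pos_le mS; exact/pos_scalar/ltW.
have FS : sigma 1 S = \sum_(i < n) f (u i) *: P i.
  by apply: mean1_steps => // i; rewrite (le_trans (ltW m0)).
have shift c : S - c%:Op = \sum_(i < n) (u i - c) *: P i.
  by rewrite -scaleNr /S sum_projectionsD.
have stepE : nrm (sigma 1 S y - (f t)%:C *: y) <= L * nrm (S y - t%:C *: y).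
  rewrite -ler_sqr ?nnegrE ?nrm_ge0//; last by rewrite mulr_ge0 ?nrm_ge0// ltW.
  have -> : S y - t%:C *: y = (S - t%:Op) y by [].
  have -> : sigma 1 S y - (f t)%:C *: y = (sigma 1 S - (f t)%:Op) y by [].
  rewrite FS -scaleNr sum_projectionsD// shift exprMn !nrm_projections//.
  rewrite mulr_sumr; apply: ler_sum => i _.
  rewrite (mulrA (L ^+ 2)); apply: ler_wpM2r; first exact: sqr_ge0.
  rewrite -exprMn -[X in X <= _]real_normK ?num_real//.
  rewrite -[X in _ <= X]real_normK ?num_real// ler_sqr ?nnegrE ?normr_ge0//.
  rewrite normrM (ger0_norm (ltW L0)).
  exact: (repr_lipschitz hs Hinf fE).
have Sd : le_op S (S + d%:Op).
  by rewrite -[X in le_op X _]addr0; apply: le_opD => //; apply/le_op0/pos_scalar.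
have dm0 : 0 <= d / m by rewrite divr_ge0 ?(ltW m0).
(* As [m <= S], the additive error [d] is a relative error [d / m], and dilating the argument by
   [1 + d / m] raises the mean by at most that factor. *)
have Sm : le_op (S + d%:Op) ((1 + d / m) *: S).
  rewrite scalerDl scale1r; apply: le_opD => //.
  have -> : d%:Op = (d / m) *: m%:Op :> bop H.
    by rewrite scalerA divfK// gt_eqF.
  exact: le_opZ.
have pF S' : positive_op S' -> positive_op (sigma 1 S').
  by move=> pS'; exact: (mean_positive hs pos1 pS').
have D0 : positive_op (sigma 1 T - sigma 1 S).
  by apply/le_opE; exact: (mean_le1 hs).
have D1 : le_op (sigma 1 T - sigma 1 S) (L * d)%:Op.
  apply: (@le_op_trans _ _ ((d / m) *: sigma 1 S)).
    apply: le_opBl.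
    have -> : sigma 1 S + (d / m) *: sigma 1 S = (1 + d / m) *: sigma 1 S.
      by rewrite scalerDl scale1r.
    have dil : le_op (sigma 1 ((1 + d / m) *: S)) ((1 + d / m) *: sigma 1 S).
      by apply: (mean1_dilate hs) => //; rewrite lerDl.
    apply: le_op_trans dil.
    by apply: (mean_le1 hs) => //; exact: le_op_trans TS Sm.
  have [_ Fb] := mean1_bounds hs Hinf fE (ltW m0) mS (le_op_trans ST Tb).
  have -> : (L * d)%:Op = (d / m) *: (f b)%:Op :> bop H.
    by rewrite scalerA; congr (_ *: _); rewrite /L; field; rewrite gt_eqF.
  exact: le_opZ.
have h1 := pos_nrm_le y (mulr_ge0 (ltW L0) d0) D0 D1.
have TSd : le_op (T - S) d%:Op by exact: le_opBl.
have h2 := pos_nrm_le y d0 (proj1 (le_opE S T) ST) TSd.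
have h3 : nrm (S y - t%:C *: y) <= d * nrm y + nrm (T y - t%:C *: y).
  rewrite -[S y](subrK (T y)) -addrA (le_trans (nrmD _ _))// lerD2r.
  by rewrite -nrmN opprB.
have h4 : nrm (sigma 1 T y - (f t)%:C *: y) <=
    L * d * nrm y + nrm (sigma 1 S y - (f t)%:C *: y).
  rewrite -[sigma 1 T y](subrK (sigma 1 S y)) -addrA (le_trans (nrmD _ _))//.
  by rewrite lerD2r.
have ne' : 2 * L * d * nrm y <= e.
  by apply: le_trans ne; rewrite le_eqVlt; apply/orP/or_introl/eqP;
    rewrite /d; ring.
have := ler_wpM2l (ltW L0) h3; rewrite -/L; lra.
Qed.

End ApproximateEigenvectors.

Section JointContinuity.
Context {R : realType} {H : hilbertType R}.
Implicit Types (A B C D P Q S T V : bop H) (x y : H) (a b c d m r s t : R).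

(** [|S x|^2 = <A x, x>] is at most [c |x|^2]; the factor [1 + c] is a root-free majorant of the
    square root of [c]. *)
Lemma sqrt_nrm_le A S c x : 0 <= c -> positive_op S -> S * S = A ->
  le_op A c%:Op -> nrm (S x) <= (1 + c) * nrm x.
Proof.
move=> c0 pS SS Ac; apply: nrm_le; first by rewrite mulr_ge0 ?nrm_ge0 ?addr_ge0.
rewrite (pos_sa pS) -bop_mulE SS ripC (le_trans (le_rip x Ac))// !bopE ripZl.
by rewrite exprMn -rip_nrm ler_wpM2r ?rip_xx_ge0//; nra.
Qed.

Lemma inverse_nrm_le A S S' c x : 0 < c -> positive_op S -> S * S = A ->
  S * S' = 1 -> le_op c%:Op A -> nrm (S' x) <= (1 + c^-1) * nrm x.
Proof.
move=> c0 pS SS SS' cA; have c0' : 0 <= c^-1 by rewrite invr_ge0 ltW.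
apply: nrm_le; first by rewrite mulr_ge0 ?nrm_ge0 ?addr_ge0.
have := le_rip (S' x) cA; rewrite -SS !bopE ripZl (pos_sa pS).
rewrite -[S (S' x)]/((S * S') x) SS' bopE.
rewrite mulrC -ler_pdivlMr// => /le_trans; apply.
rewrite mulrC exprMn -rip_nrm ler_wpM2r ?rip_xx_ge0//; nra.
Qed.

(** The arithmetic-geometric mean inequality. It trades norms of spectral pieces, whose sum may grow
    with their number, for squares, which add up to a fixed total. *)
Lemma average_nrm_le (u d : R) : 0 < d -> u <= (d + u ^+ 2 / d) / 2.
Proof.
move=> d0; rewrite -subr_ge0.
have -> : (d + u ^+ 2 / d) / 2 - u = (u - d) ^+ 2 / (2 * d) by field; lra.
by rewrite divr_ge0 ?sqr_ge0// mulr_ge0 ?ltW.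
Qed.

(* The components of [x] are approximate eigenvectors of the pencil [B - t A]. *)
Lemma pencil_decomposition A B m b x (e : R) : posinv_op A -> m <= b ->
  le_op (m *: A) B -> le_op B (b *: A) -> 0 < e ->
  exists n (y : 'I_n -> H) (t : 'I_n -> R),
    [/\ \sum_(i < n) y i = x, forall i, m <= t i <= b &
        \sum_(i < n) nrm (B (y i) - (t i)%:C *: A (y i)) <= e].
Proof.
move=> iA mb mB Bb e0; have [S [S' [pS pS' SS SS' S'S]]] := posinv_sqrt iA.
have [mT Tb] := conj_bounds SS SS' S'S (pos_sa pS') mB Bb.
set T := S' * B * S' in mT Tb.
have saT : sa T.
  have /le_opE/pos_sa h := mT; rewrite -[T](subrK m%:Op).
  exact/saD/saZ/sa1.
have [c c0 Sc] := bop_bound S; pose w := S x.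
pose k := c * (b - m).
have k0 : 0 <= k by rewrite mulr_ge0 ?subr_ge0 ?(ltW c0).
(* [d] and [n] balance the two terms of [average_nrm_le] *)
pose d := e / (1 + k); have d0 : 0 < d by rewrite divr_gt0// ltr_pwDl.
have [n n0 ne] := archimedean_quotient (k * (nrm w ^+ 2 / d)) e0.
have [P /= [oP sP ST TS]] := spectral_steps mb n0 saT mT Tb.
pose h := (b - m) / n%:R; rewrite -/h in ST TS.
have h0 : 0 <= h by rewrite divr_ge0 ?subr_ge0 ?ler0n.
pose t := fun i : 'I_n => m + i%:R * h.
pose U := \sum_(i < n) t i *: P i; rewrite -/U in ST TS.
(* Spectral pieces of [w = A^(1/2) x], pulled back by [A^(-1/2)]: for such [y], the vector
   [B y - t A y] is [S] applied to [(T - U) (P i w)], hence at most [c * h * nrm (P i w)] in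
   norm. *)
exists n, (fun i => S' (P i w)), t; split => [|i|].
- rewrite -linear_sum -bop_sumE sP /w -[LHS]/((S' * 1 * S) x).
  by rewrite mulr1 S'S.
- exact: step_range.
have TUh : le_op (T - U) h%:Op by exact: le_opBl.
have TU0 : positive_op (T - U) by exact/le_opE.
have est i : nrm (B (S' (P i w)) - (t i)%:C *: A (S' (P i w))) <=
    c * h * ((d + nrm (P i w) ^+ 2 / d) / 2).
  have -> : B (S' (P i w)) - (t i)%:C *: A (S' (P i w)) = S ((T - U) (P i w)).
    have BE : B * S' = S * T by rewrite /T !mulrA SS' mul1r.
    have AE : A * S' = S by rewrite -SS -mulrA SS' mulr1.
    have UP : U * P i = t i *: P i by exact: orthogonal_mulr.
    rewrite -[B (S' _)]/((B * S') (P i w)) BE -[A (S' _)]/((A * S') (P i w)) AE.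
    have -> : (T - U) (P i w) = T (P i w) - (t i)%:C *: P i w.
      by rewrite -bop_scaleE -UP.
    by rewrite linearB /= (linearZ_LR S).
  apply: le_trans (Sc _) _; rewrite -mulrA ler_wpM2l ?(ltW c0)//.
  apply: le_trans (pos_nrm_le _ h0 TU0 TUh) _; rewrite ler_wpM2l//.
  exact: average_nrm_le.
apply: le_trans (ler_sum _ (fun i _ => est i)) _.
have sw : \sum_(i < n) nrm (P i w) ^+ 2 = nrm w ^+ 2.
  have := nrm_projections (fun=> 1) w oP.
  under eq_bigr do rewrite scale1r; rewrite sP bopE => ->.
  by apply: eq_bigr => i _; rewrite expr1n mul1r.
rewrite -mulr_sumr -mulr_suml big_split /= sumr_const card_ord -mulr_suml sw.
have -> : c * h * ((d *+ n + nrm w ^+ 2 / d) / 2) =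
    (k * d + k * (nrm w ^+ 2 / d) / n%:R) / 2.
  have n0' : n%:R != 0 :> R by rewrite pnatr_eq0 -lt0n.
  by rewrite -mulr_natr /k /h; field; rewrite n0' gt_eqF.
have kd : k * d <= e.
  by rewrite /d mulrA ler_pdivrMr ?ltr_pwDl// mulrC ler_wpM2l ?(ltW e0)// lerDr.
lra.
Qed.

Variable sigma : bop H -> bop H -> bop H.
Hypothesis hs : operator_mean sigma.
Hypothesis Hinf : infinite_dimensional H.
Variable f : R -> R.
Hypothesis fE : forall t, 0 <= t -> sigma 1 t%:Op = (f t)%:Op.

(** Conjugation by the root of [A] reduces this to [mean1_lipschitz]. [K] depends on the bounds
    alone, so it serves a whole sequence of pairs; the absolute value is there because [f b] is
    known to be positive only once some [t] in [[m, b]] is given. *)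
Lemma mean_lipschitz a b c m : 0 < a -> 0 < m -> 0 < c ->
  exists2 K, 0 <= K & forall A B t y, le_op a%:Op A -> le_op A c%:Op ->
    le_op (m *: A) B -> le_op B (b *: A) -> m <= t <= b ->
    nrm (sigma A B y - (f t)%:C *: A y) <= K * nrm (B y - t%:C *: A y).
Proof.
move=> a0 m0 c0; pose K := (1 + c) * (`|f b| / m) * (1 + a^-1).
have a0' : 0 <= a^-1 by rewrite invr_ge0 ltW.
exists K.
  by rewrite !mulr_ge0 ?addr_ge0 ?(ltW c0)// invr_ge0 ltW.
move=> A B t y aA Ac mB Bb mtb.
have iA : posinv_op A by apply: posinv_le aA; exact: posinv_scalar.
have pB : positive_op B.
  by apply: pos_le mB; apply: posZ (posinv_pos iA); exact: ltW.
have [S [S' [pS pS' SS SS' S'S]]] := posinv_sqrt iA.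
have [mT Tb] := conj_bounds SS SS' S'S (pos_sa pS') mB Bb.
rewrite (mean_formula hs pS pS' SS SS' S'S pB).
set T := S' * B * S' in mT Tb *.
have -> : (S * sigma 1 T * S) y - (f t)%:C *: A y =
    S (sigma 1 T (S y) - (f t)%:C *: S y).
  by rewrite -SS linearB /= (linearZ_LR S).
apply: le_trans (sqrt_nrm_le _ (ltW c0) pS SS Ac) _.
have -> : K * nrm (B y - t%:C *: A y) =
    (1 + c) * (`|f b| / m * ((1 + a^-1) * nrm (B y - t%:C *: A y))).
  by rewrite /K !mulrA.
rewrite ler_wpM2l ?addr_ge0 ?(ltW c0)//.
have fb0 : 0 < f b.
  case/andP: mtb => mt tb; apply: (repr_gt0 hs Hinf fE).
  by rewrite (lt_le_trans m0)// (le_trans mt).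
rewrite gtr0_norm//; apply: le_trans (mean1_lipschitz hs Hinf fE _ m0 mtb mT Tb) _.
rewrite ler_wpM2l ?divr_ge0 ?(ltW fb0) ?(ltW m0)//.
have -> : T (S y) - t%:C *: S y = S' (B y - t%:C *: A y).
  have TS : T * S = S' * B by rewrite /T -mulrA S'S mulr1.
  have S'A : S' * A = S by rewrite -SS mulrA S'S mul1r.
  by rewrite -bop_mulE TS (linearB S') (linearZ_LR S') /= -S'A.
exact: inverse_nrm_le SS SS' aA.
Qed.

Lemma eq0_le_small (u c : R) : 0 <= c -> 0 <= u ->
  (forall e, 0 < e -> u <= c * e) -> u = 0.
Proof.
move=> c0 u0 h; apply/eqP; rewrite eq_le u0 andbT; apply/ler_addgt0Pr => e e0.
have c1 : 0 < 1 + c by rewrite ltr_pwDl.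
rewrite add0r; apply: le_trans (h (e / (1 + c)) _) _; first exact: divr_gt0.
by rewrite mulrA ler_pdivrMr// mulrC ler_wpM2l ?(ltW e0)// lerDr.
Qed.

(** If [B y = t A y], then [V y] with [V = S^-1] solves the same equation for the transformed pair,
    and both sides of the claim, applied to [V y], are [f(t) S' A y]. The decomposition of [S x]
    makes this exact up to an arbitrary [e]. *)
Lemma mean_congruence A B S S' : posinv_op A -> posinv_op B ->
  bop_invertible S -> is_adjoint S S' ->
  S' * sigma A B * S = sigma (S' * A * S) (S' * B * S).
Proof.
move=> iA iB iS adj; have [V [SV VS]] := iS.
have {}SV : S * V = 1 by []. have {}VS : V * S = 1 by [].
have [m m0 [b mb [mB Bb]]] := posinv_relative iA iB.
have mB' : le_op (m *: (S' * A * S)) (S' * B * S).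
  by have := le_op_adj adj mB; rewrite -bop_scaleAr -bop_scaleAl.
have Bb' : le_op (S' * B * S) (b *: (S' * A * S)).
  by have := le_op_adj adj Bb; rewrite -bop_scaleAr -bop_scaleAl.
have [a a0 [c c0 [aA Ac]]] := posinv_bounds iA.
have [a' a0' [c' c0' [aA' Ac']]] := posinv_bounds (posinv_adj iA iS adj).
have [K K0 lip] := mean_lipschitz b a0 m0 c0.
have [K' K0' lip'] := mean_lipschitz b a0' m0 c0'.
have [s s0 S's] := bop_bound S'.
apply/bop_eqP => x; apply/subr0_eq/eqP; rewrite -nrm_eq0; apply/eqP.
apply: (@eq0_le_small _ (s * K + K' * s)); rewrite ?nrm_ge0//.
  by rewrite addr_ge0// mulr_ge0// ltW.
move=> e e0.
have [n [y [t [yx tmb ye]]]] := pencil_decomposition (S x) iA mb mB Bb e0.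
have xE : x = \sum_(i < n) V (y i).
  by rewrite -linear_sum yx -[LHS]/((1 : bop H) x) -VS.
have -> : (S' * sigma A B * S) x - sigma (S' * A * S) (S' * B * S) x =
    \sum_(i < n) (S' (sigma A B (y i) - (f (t i))%:C *: A (y i)) -
      (sigma (S' * A * S) (S' * B * S) (V (y i)) -
        (f (t i))%:C *: (S' * A * S) (V (y i)))).
  have -> : (S' * sigma A B * S) x = \sum_(i < n) S' (sigma A B (y i)).
    by rewrite !bop_mulE -yx (linear_sum (sigma A B)) (linear_sum S').
  rewrite [X in _ - bop_fun _ X]xE linear_sum -sumrB; apply: eq_bigr => i _.
  rewrite linearB /= (linearZ_LR S') /= -[S (V _)]/((S * V) (y i)) SV bopE.
  by rewrite opprB addrA subrK.
apply: le_trans (nrm_sum _ _) _.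
apply: (@le_trans _ _ ((s * K + K' * s) *
    \sum_(i < n) nrm (B (y i) - (t i)%:C *: A (y i)))); last first.
  by rewrite ler_wpM2l// addr_ge0// mulr_ge0// ltW.
rewrite mulr_sumr; apply: ler_sum => i _.
apply: le_trans (nrmB _ _) _; rewrite mulrDl; apply: lerD.
  apply: le_trans (S's _) _; rewrite -mulrA ler_wpM2l ?(ltW s0)//.
  exact: lip.
apply: le_trans (lip' _ _ _ _ aA' Ac' mB' Bb' (tmb i)) _.
rewrite -(mulrA K') ler_wpM2l//; apply: le_trans _ (S's _).
rewrite !bopE -[S (V _)]/((S * V) (y i)) SV bopE.
by rewrite (linearB S') (linearZ_LR S').
Qed.

(** The vectors [y i] are chosen for the limit pair and then kept fixed. At each of them both means
    are compared with [f (t i)] times the first operator, and only finitely many vectors have to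
    converge. *)
Lemma mean_sot (Ak Bk : nat -> bop H) A B a b c m :
  0 < a -> 0 < m -> 0 < c -> m <= b ->
  (forall k, [/\ le_op a%:Op (Ak k), le_op (Ak k) c%:Op,
    le_op (m *: Ak k) (Bk k) & le_op (Bk k) (b *: Ak k)]) ->
  sot_cvg Ak A -> sot_cvg Bk B ->
  sot_cvg (fun k => sigma (Ak k) (Bk k)) (sigma A B).
Proof.
move=> a0 m0 c0 mb bnd AkA BkB x.
have aA : le_op a%:Op A.
  by apply: (sot_le _ (@sot_cst _ _ _) AkA) => k; case: (bnd k).
have Ac : le_op A c%:Op.
  by apply: (sot_le _ AkA (@sot_cst _ _ _)) => k; case: (bnd k).
have mB : le_op (m *: A) B.
  by apply: (sot_le _ (@sotZ _ _ m _ _ AkA) BkB) => k; case: (bnd k).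
have Bb : le_op B (b *: A).
  by apply: (sot_le _ BkB (@sotZ _ _ b _ _ AkA)) => k; case: (bnd k).
have iA : posinv_op A by apply: posinv_le aA; exact: posinv_scalar.
have [K K0 lip] := mean_lipschitz b a0 m0 c0.
have fb0 : 0 < f b by apply: (repr_gt0 hs Hinf fE); exact: lt_le_trans mb.
have b0 : 0 < b by exact: lt_le_trans mb.
apply/hcvgP/cvgrPdist_lt => e e0.
(* The residuals enter twice with factor [K], so they cost at most [2 * K * d <= e / 2]; the terms
   that vanish with [k], collected in [g], take the other half. *)
pose d := e / (4 * (1 + K)).
have K1 : 0 < 1 + K by rewrite ltr_pwDl.
have d0 : 0 < d by rewrite divr_gt0// mulr_gt0.
have [n [y [t [yx tmb ye]]]] := pencil_decomposition x iA mb mB Bb d0.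
pose g k := \sum_(i < n) ((K * b + f b) * nrm (Ak k (y i) - A (y i)) +
  K * nrm (Bk k (y i) - B (y i))).
have g0 : g k @[k --> \oo] --> (0 : R).
  have -> : (0 : R) = \sum_(i < n) ((K * b + f b) * 0 + K * 0).
    by rewrite big1// => i _; rewrite !mulr0 addr0.
  apply: cvg_big => [|i _]; first exact: add_continuous.
  apply: cvgD; apply: cvgMr.
    exact/hcvgP/AkA.
  exact/hcvgP/BkB.
have e2 : 0 < e / 2 by rewrite divr_gt0.
move/cvgrPdist_lt : g0 => /(_ _ e2); apply: filterS => k.
rewrite !sub0r !normrN [X in _ -> X < _]ger0_norm ?nrm_ge0// => gk.
have {}gk := le_lt_trans (ler_norm _) gk.
have [aAk Akc mBk Bkb] := bnd k.
suff h : nrm (sigma (Ak k) (Bk k) x - sigma A B x) <= g k + 2 * K * d.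
  apply: le_lt_trans h _.
  have : 2 * K * d <= e / 2.
    rewrite /d mulrA ler_pdivrMr ?mulr_gt0//; nra.
  lra.
have -> : sigma (Ak k) (Bk k) x - sigma A B x =
    \sum_(i < n) ((sigma (Ak k) (Bk k) (y i) - (f (t i))%:C *: Ak k (y i)) +
      (f (t i))%:C *: (Ak k (y i) - A (y i)) -
      (sigma A B (y i) - (f (t i))%:C *: A (y i))).
  rewrite -yx (linear_sum (sigma _ _)) (linear_sum (sigma A B)) -sumrB.
  apply: eq_bigr => i _.
  by rewrite scalerBr addrA subrK opprB addrA subrK.
apply: le_trans (nrm_sum _ _) _.
apply: (@le_trans _ _ (g k + 2 * K *
    \sum_(i < n) nrm (B (y i) - (t i)%:C *: A (y i)))); last first.
  by rewrite lerD2l ler_wpM2l// mulr_ge0.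
rewrite mulr_sumr /g -big_split /=; apply: ler_sum => i _.
have /andP[mt tb] := tmb i; have t0 := lt_le_trans m0 mt.
have h1 := lip _ _ _ (y i) aAk Akc mBk Bkb (tmb i).
have h2 := lip _ _ _ (y i) aA Ac mB Bb (tmb i).
have h3 : nrm ((f (t i))%:C *: (Ak k (y i) - A (y i))) <=
    f b * nrm (Ak k (y i) - A (y i)).
  rewrite nrmZ ler_wpM2r ?nrm_ge0// gtr0_norm ?(repr_gt0 hs Hinf fE)//.
  by apply: (repr_mono hs Hinf fE) => //; exact: ltW.
have h4 : nrm (Bk k (y i) - (t i)%:C *: Ak k (y i)) <=
    nrm (B (y i) - (t i)%:C *: A (y i)) + nrm (Bk k (y i) - B (y i)) +
    b * nrm (Ak k (y i) - A (y i)).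
  have -> : Bk k (y i) - (t i)%:C *: Ak k (y i) =
      (B (y i) - (t i)%:C *: A (y i)) + (Bk k (y i) - B (y i)) -
      (t i)%:C *: (Ak k (y i) - A (y i)).
    rewrite scalerBr opprB addrA; congr (_ - _).
    by rewrite addrAC subrK addrC subrK.
  apply: le_trans (nrmB _ _) _; apply: lerD; first exact: nrmD.
  by rewrite nrmZ gtr0_norm// ler_wpM2r ?nrm_ge0.
have := ler_wpM2l K0 h4.
have := nrmB (sigma (Ak k) (Bk k) (y i) - (f (t i))%:C *: Ak k (y i) +
      (f (t i))%:C *: (Ak k (y i) - A (y i)))
      (sigma A B (y i) - (f (t i))%:C *: A (y i)).
have := nrmD (sigma (Ak k) (Bk k) (y i) - (f (t i))%:C *: Ak k (y i))
      ((f (t i))%:C *: (Ak k (y i) - A (y i))).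
rewrite !mulrDr; lra.
Qed.

End JointContinuity.

(** * The fixed point equation *)

Section FixedPoints.
Context {R : realType} {H : hilbertType R}.
Variables (n : nat) (M : ('I_n -> bop H) -> bop H).
Variable sigma : bop H -> bop H -> bop H.
Hypothesis hM : multi_operator_mean M.
Hypothesis hs : operator_mean sigma.
Hypothesis Hinf : infinite_dimensional H.
Hypothesis nl : ~ left_trivial sigma.
Implicit Types (X Y Z : bop H) (A : 'I_n -> bop H) (c : R).

Definition mean_map A X : bop H := M (fun j => sigma X (A j)).
Local Notation G := mean_map.

(** Homogeneity covers [c > 0]; the value at 0 is the limit along the constants [k.+1%:R^-1]. *)
Lemma mean_cst c : 0 <= c -> sigma c%:Op c%:Op = c%:Op.
Proof.
have p1 := @pos1 R H; rewrite le_eqVlt => /predU1P[<-|c0]; last first.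
  by rewrite mean_scale// (mean_normalized hs).
have posn k : 0 < k.+1%:R^-1 :> R by rewrite invr_gt0 ltr0n.
have [_ h] := mean_continuous hs (fun k => posinv_pos (shift_posinv k (@pos0 R H)))
  (fun k => posinv_pos (shift_posinv k (@pos0 R H))) pos0 pos0
  (shift_decreases 0) (shift_decreases 0).
rewrite scale0r; apply: (sot_unique h); rewrite -[X in sot_cvg _ X](@add0r _ 0).
have -> : (fun k => sigma (0 + k.+1%:R^-1%:Op) (0 + k.+1%:R^-1%:Op)) =
    (fun k => 0 + k.+1%:R^-1%:Op).
  apply/funext => k; rewrite add0r mean_scale// (mean_normalized hs).
  by [].
by rewrite addr0; exact: shift_cvg.
Qed.

Lemma posinv_mean X Y : posinv_op X -> posinv_op Y -> posinv_op (sigma X Y).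
Proof.
move=> iX iY; have [a a0 [_ _ [aX _]]] := posinv_bounds iX.
have [b b0 [_ _ [bY _]]] := posinv_bounds iY.
pose c := Num.min a b; have c0 : 0 < c by rewrite lt_min a0.
have p1 := @pos1 R H.
apply: (posinv_le (posinv_scalar c0)); rewrite -(mean_cst (ltW c0)).
have cX : le_op c%:Op X.
  by apply: le_op_trans aX; apply: le_opZl => //; rewrite ge_min lexx.
have cY : le_op c%:Op Y.
  by apply: le_op_trans bY; apply: le_opZl => //; rewrite ge_min lexx orbT.
by apply: (mean_monotone hs) => //; try exact: posinv_pos;
  apply/pos_scalar/ltW.
Qed.

Lemma mmean_scale c A : 0 < c -> (forall j, posinv_op (A j)) ->
  M (fun j => c *: A j) = c *: M A.
Proof.
move=> c0 iA; pose r := Num.sqrt c.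
have r0 : 0 < r by rewrite sqrtr_gt0.
have rE T : r%:Op * (T * r%:Op) = c *: T :> bop H.
  rewrite -bop_scaleAl mul1r -bop_scaleAr mulr1 scalerA -expr2 sqr_sqrtr//.
  exact: ltW.
have inv : bop_invertible (r%:Op : bop H).
  by have [] := posinv_scalar r0 (H := H).
have adj : is_adjoint (r%:Op : bop H) r%:Op.
  by move=> x y; apply: sa_inner; exact/saZ/sa1.
have := mmean_congruence hM iA inv adj; rewrite [LHS]rE => ->.
by congr M; apply/funext => j; rewrite [RHS]rE.
Qed.

(** Merges one constant per index into a common one. The floor [l] lets the caller keep that
    constant away from an unwanted range. *)
Lemma finite_uniform (Q : 'I_n -> R -> Prop) (l u : R) : l < u ->
  (forall j, exists2 b, b < u & Q j b) ->
  (forall j b b', b <= b' -> b' < u -> Q j b -> Q j b') ->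
  exists2 b, l <= b < u & forall j, Q j b.
Proof.
move=> lu ex up; have /choice[g gQ] : forall j, exists b, b < u /\ Q j b.
  by move=> j; have [b bu Qb] := ex j; exists b.
have gu j : g j < u by case: (gQ j).
pose b := \big[Num.max/l]_j g j.
have bu : b < u by apply: bigmax_lt.
exists b; first by rewrite bu bigmax_ge_id.
by move=> j; apply: (up j (g j)) => //; [exact: le_bigmax|case: (gQ j)].
Qed.

Section FixedArguments.
Variable A : 'I_n -> bop H.
Hypothesis iA : forall j, posinv_op (A j).

Lemma fix_posinv X : posinv_op X -> posinv_op (G A X).
Proof. by move=> iX; apply: (mmean_posinv hM) => j; exact: posinv_mean. Qed.

Lemma fix_monotone X Y : posinv_op X -> le_op X Y -> le_op (G A X) (G A Y).
Proof.
move=> iX XY; have iY := posinv_le iX XY.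
apply: (mmean_monotone hM) => j; try exact: posinv_mean.
by apply: (mean_monotone hs) => //; exact: posinv_pos.
Qed.

(** Homogeneity of [sigma] and [M] moves the dilation to the data: [G A (c *: X)] is [c] times [M]
    at the means [sigma X (c^-1 *: A j)], each of which [mean_contract] bounds. *)
Lemma fix_contract c X : 1 < c -> posinv_op X ->
  exists2 b, b < 1 & le_op (G A (c *: X)) ((c * b) *: G A X).
Proof.
move=> c1 iX; have c0 := lt_trans ltr01 c1.
have [f fE] := mean_scalar hs Hinf.
have iciA j : posinv_op (c^-1 *: A j) by apply: posinvZ => //; rewrite invr_gt0.
(* This floor keeps the common factor positive, as [mmean_scale] requires. *)
have h01 : 2^-1 < 1 :> R by rewrite invf_lt1// ltr1n.
have [j|j b b' bb' _ h|b /andP[b0 b1] hb] := @finite_uniform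
  (fun j b => le_op (sigma X (c^-1 *: A j)) (b *: sigma X (A j))) _ _ h01.
- have [b [/andP[_ b1] h]] := mean_contract hs Hinf fE nl iX (iA j) c1.
  by exists b.
- by apply: le_op_trans h _; apply: le_opZl => //; apply/posinv_pos/posinv_mean.
have {}b0 : 0 < b by rewrite (lt_le_trans _ b0)// invr_gt0.
exists b => //.
have -> : G A (c *: X) = c *: M (fun j => sigma X (c^-1 *: A j)).
  rewrite -mmean_scale//; last by move=> j; exact: posinv_mean.
  congr M; apply/funext => j; rewrite -mean_scale//; try exact: posinv_pos.
  by rewrite scalerA mulfV ?scale1r// gt_eqF.
rewrite -scalerA /G -(mmean_scale b0); last by move=> j; exact: posinv_mean.
apply: le_opZ; first exact: ltW.
by apply: (mmean_monotone hM) => // j; [|apply: posinvZ => //];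
  exact: posinv_mean.
Qed.

(* If [a] is the least scalar at least 1 with [Y <= a Z], then [a = 1]:
   otherwise [Y <= G Y <= G (a Z) <= a b G Z <= a b Z] for some [b < 1]. *)
Lemma fix_compare Y Z : posinv_op Y -> posinv_op Z ->
  le_op Y (G A Y) -> le_op (G A Z) Z -> le_op Y Z.
Proof.
move=> iY iZ subY supZ; have pZ := posinv_pos iZ.
pose E : set R := [set a | 1 <= a /\ le_op Y (a *: Z)].
have [_ _ [b _ [_ Yb]]] := posinv_relative iZ iY.
have E0 : E (Num.max b 1).
  split; first by rewrite le_max lexx orbT.
  by apply: le_op_trans Yb _; apply: le_opZl => //; rewrite le_max lexx.
have Elb : has_lbound E by exists 1 => a [].
pose a := inf E.
have a1 : 1 <= a by apply: lb_le_inf; [exists (Num.max b 1)|move=> r []].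
have Ya : le_op Y (a *: Z).
  apply: le_opI; [exact/pos_sa/posinv_pos|exact/saZ/pos_sa|move=> x].
  rewrite bopE ripZl; apply/ler_addgt0Pr => e e0.
  have z0 := pos_ge0 x pZ; set z := rip (Z x) x in z0 *.
  (* The infimum is attained: an excess below [e / (1 + z)] over [a] costs at most [e] in the form
     at [x]. *)
  have k0 : 0 < e / (1 + z) by rewrite divr_gt0// ltr_pwDl.
  have [r [r1 /(le_rip x)]] := inf_adherent k0 (conj (ex_intro _ _ E0) Elb).
  rewrite -/a bopE ripZl -/z => Yr ra; apply: le_trans Yr _.
  apply: (@le_trans _ _ ((a + e / (1 + z)) * z)).
    by rewrite ler_wpM2r// ltW.
  rewrite mulrDl lerD2l mulrAC ler_pdivrMr ?ltr_pwDl//.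
  by rewrite ler_wpM2l ?(ltW e0)// lerDr.
have [a1'|a1'] := leP a 1.
  by rewrite -[Z]scale1r (_ : 1 = a)//; apply/eqP; rewrite eq_le a1 a1'.
have a0 := lt_trans ltr01 a1'.
have [d d1 h] := fix_contract a1' iZ.
have Yad : le_op Y ((a * Num.max d 0) *: Z).
  apply: le_op_trans subY _; apply: le_op_trans (fix_monotone iY Ya) _.
  apply: le_op_trans h _; apply: (@le_op_trans _ _ ((a * Num.max d 0) *: G A Z)).
    apply: le_opZl; last exact/posinv_pos/fix_posinv.
    by rewrite ler_wpM2l ?(ltW a0)// le_max lexx.
  by apply: le_opZ => //; rewrite mulr_ge0 ?(ltW a0)// le_max lexx orbT.
(* Membership in [E] asks for a scalar of at least 1, hence the outer maximum. The first alternative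
   then contradicts [Num.max d 0 < 1], the second [1 < a]. *)
have : a <= Num.max (a * Num.max d 0) 1.
  apply: ge_inf => //; split; first by rewrite le_max lexx orbT.
  by apply: le_op_trans Yad _; apply: le_opZl => //; rewrite le_max lexx.
rewrite le_max => /orP[|/(lt_le_trans a1')]; last by rewrite ltxx.
by rewrite leNgt gtr_pMr// gt_max d1 ltr01.
Qed.

Lemma fix_unique X Y : posinv_op X -> posinv_op Y -> X = G A X -> Y = G A Y ->
  X = Y.
Proof.
move=> iX iY XE YE; apply: le_op_anti; apply: fix_compare => //.
- by rewrite -XE.
- by rewrite -YE.
- by rewrite -YE.
- by rewrite -XE.
Qed.

Lemma fix_cst c : 0 < c -> M (fun=> c%:Op) = c%:Op.
Proof.
move=> c0; have i1 : posinv_op (1 : bop H).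
  by rewrite -[1]scale1r; exact: posinv_scalar.
by rewrite mmean_scale// (mmean_normalized hM).
Qed.

Lemma uniform_bounds : exists2 c, 0 < c <= 1 &
  forall j, le_op c%:Op (A j) /\ le_op (A j) c^-1%:Op.
Proof.
have p1 := @pos1 R H.
(* Admissible constants persist when lowered, whereas [finite_uniform] raises its parameter; hence
   the sign change. The floor -1 becomes the bound [c <= 1]. *)
have m10 : -1 < 0 :> R by rewrite ltrN10.
have [j|j b b' bb' b'0 [h1 h2]|b /andP[b1 b0] hb] := @finite_uniform
  (fun j b => le_op (- b)%:Op (A j) /\ le_op (A j) (- b)^-1%:Op) _ _ m10.
- have [a a0 [d d0 [aA Ad]]] := posinv_bounds (iA j).
  pose m := Num.min a d^-1.
  have m0 : 0 < m by rewrite lt_min a0 invr_gt0.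
  exists (- m); rewrite ?oppr_lt0// opprK; split.
    by apply: le_op_trans aA; apply: le_opZl => //; rewrite ge_min lexx.
  apply: le_op_trans Ad _; apply: le_opZl => //.
  by rewrite -[d]invrK lef_pV2 ?posrE ?invr_gt0// ge_min lexx orbT.
- split; first by apply: le_op_trans h1; apply: le_opZl => //; rewrite lerN2.
  apply: le_op_trans h2 _; apply: le_opZl => //.
  by rewrite lef_pV2 ?posrE ?oppr_gt0 ?lerN2// (le_lt_trans bb').
by exists (- b); rewrite // oppr_gt0 b0 lerNl.
Qed.

(** Along decreasing sequences the continuity axioms of [sigma] and [M] chain directly. *)
Lemma mmean_fix_cvg (Xk : nat -> bop H) (Ak : 'I_n -> nat -> bop H) X :
  (forall k, posinv_op (Xk k)) -> (forall j k, posinv_op (Ak j k)) ->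
  posinv_op X -> decreases_to Xk X -> (forall j, decreases_to (Ak j) (A j)) ->
  sot_cvg (fun k => G (fun j => Ak j k) (Xk k)) (G A X).
Proof.
move=> iXk iAk iX XkX AkA.
apply: (mmean_continuous hM (Ak := fun j k => sigma (Xk k) (Ak j k))).
- by move=> j k; exact: posinv_mean.
- by move=> j; exact: posinv_mean.
left=> j; apply: (mean_continuous hs) => //; try exact: posinv_pos.
  by move=> k; exact: posinv_pos.
by move=> k; exact: posinv_pos.
Qed.

Lemma fix_exists : exists2 X, posinv_op X & X = G A X.
Proof.
have [c /andP[c0 c1] cA] := uniform_bounds; have p1 := @pos1 R H.
have ic0 : 0 < c^-1 by rewrite invr_gt0.
have isc d : 0 < d -> posinv_op (d%:Op : bop H) := @posinv_scalar _ _ d.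
have psc d : 0 < d -> positive_op (d%:Op : bop H).
  by move=> d0; exact/pos_scalar/ltW.
(* Both means fix constants, so replacing each [A j] by its bound [c^-1] or [c] makes the equation
   exact; this gives a constant supersolution and a constant subsolution. *)
have upper : le_op (G A c^-1%:Op) c^-1%:Op.
  rewrite -[X in le_op _ X](fix_cst ic0); apply: (mmean_monotone hM) => j.
  - by apply: posinv_mean => //; exact: isc.
  - exact: isc.
  rewrite -[X in le_op _ X](mean_cst (ltW ic0)).
  apply: (mean_monotone hs) => //; try exact: psc; first exact/posinv_pos.
  by case: (cA j).
have lower : le_op c%:Op (G A c%:Op).
  rewrite -[X in le_op X _](fix_cst c0); apply: (mmean_monotone hM) => j.
  - exact: isc.
  - by apply: posinv_mean => //; exact: isc.
  rewrite -[X in le_op X _](mean_cst (ltW c0)).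
  apply: (mean_monotone hs) => //; try exact: psc; first exact/posinv_pos.
  by case: (cA j).
pose Z k := iter k (G A) c^-1%:Op.
have cZ k : le_op c%:Op (Z k).
  elim: k => [|k IHk]; last first.
    by apply: le_op_trans lower _; apply: fix_monotone => //; exact: isc.
  by apply: le_opZl => //; rewrite (le_trans c1)// invf_ge1.
have iZ k : posinv_op (Z k) by apply: posinv_le (cZ k); exact: isc.
have Zstep k : le_op (Z k.+1) (Z k).
  by elim: k => [|k IHk]; [exact: upper|exact: fix_monotone (iZ _) IHk].
have Z_dec k l : (k <= l)%N -> le_op (Z l) (Z k).
  move=> /subnK <-; elim: (l - k)%N => [//|m IHm].
  by apply: le_op_trans IHm; rewrite addSn.
have [X ZX] := decreasing_cvg_ge cZ Z_dec.
(* The subsolution [c%:Op] stays below all iterates and keeps the limit invertible. *)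
have iX : posinv_op X.
  apply: (posinv_le (isc _ c0)).
  exact: (sot_le cZ (@sot_cst _ _ _) ZX).
exists X => //; apply: (sot_unique (sot_shift ZX)).
apply: (@mmean_fix_cvg Z (fun j => fun=> A j)) => // j.
by split=> [k l _|]; [exact: le_op_refl|exact: sot_cst].
Qed.

End FixedArguments.

(** Any selection of solutions; its values at tuples that are not positive invertible stay
    arbitrary. *)
Variable Ms : ('I_n -> bop H) -> bop H.
Hypothesis Ms_fix : forall A, (forall j, posinv_op (A j)) ->
  posinv_op (Ms A) /\ Ms A = G A (Ms A).

(** The solution for [A] is a subsolution for [B], so the comparison principle applies. *)
Lemma solution_monotone A B : (forall j, posinv_op (A j)) ->
  (forall j, posinv_op (B j)) -> (forall j, le_op (A j) (B j)) ->
  le_op (Ms A) (Ms B).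
Proof.
move=> iA iB AB; have [iX XE] := Ms_fix iA; have [iY YE] := Ms_fix iB.
apply: (fix_compare iB) => //; last by rewrite -YE.
rewrite {1}XE; apply: (mmean_monotone hM) => j; try exact: posinv_mean.
by apply: (mean_monotone hs) => //; exact: posinv_pos.
Qed.

Lemma solution_congruence A S S' : (forall j, posinv_op (A j)) ->
  bop_invertible S -> is_adjoint S S' ->
  S' * Ms A * S = Ms (fun j => S' * A j * S).
Proof.
move=> iA iS adj; have [iX XE] := Ms_fix iA.
have iA' j : posinv_op (S' * A j * S) by exact: posinv_adj.
have [iY YE] := Ms_fix iA'.
apply: (fix_unique iA') => //; first exact: posinv_adj.
have iXA j : posinv_op (sigma (Ms A) (A j)) by exact: posinv_mean.
have [f fE] := mean_scalar hs Hinf.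
rewrite {1}XE -mulrA [LHS](mmean_congruence hM iXA iS adj); congr M.
apply/funext => j; rewrite -(mean_congruence hs Hinf fE iX (iA j) iS adj).
by rewrite -mulrA.
Qed.

(** The solutions decrease and stay above [Ms A], so they have an invertible limit; the equation
    passes to this limit, and uniqueness identifies it. *)
Lemma solution_decreasing (Ak : 'I_n -> nat -> bop H) A :
  (forall j k, posinv_op (Ak j k)) -> (forall j, posinv_op (A j)) ->
  (forall j, decreases_to (Ak j) (A j)) ->
  sot_cvg (fun k => Ms (fun j => Ak j k)) (Ms A).
Proof.
move=> iAk iA AkA; pose X k := Ms (fun j => Ak j k).
have iX k : posinv_op (X k) by case: (Ms_fix (fun j => iAk j k)).
have XE k : X k = G (fun j => Ak j k) (X k).
  by case: (Ms_fix (fun j => iAk j k)).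
have X_dec k l : (k <= l)%N -> le_op (X l) (X k).
  by move=> kl; apply: solution_monotone => // j; case: (AkA j) => h _; exact: h.
have [iM ME] := Ms_fix iA.
have MX k : le_op (Ms A) (X k).
  apply: solution_monotone => // j; case: (AkA j) => h1 h2.
  exact: (decreasing_le h1 h2).
have [c c0 [_ _ [cM _]]] := posinv_bounds iM.
have [L XL] : exists L, sot_cvg X L.
  by apply: (@decreasing_cvg_ge _ _ _ c) => // k; exact: le_op_trans (MX k).
have iL : posinv_op L.
  apply: (posinv_le iM); exact: (sot_le MX (@sot_cst _ _ _) XL).
have LE : L = G A L.
  apply: (sot_unique XL); have := mmean_fix_cvg iA iX iAk iL (conj X_dec XL) AkA.
  by have -> : (fun k => G (fun j => Ak j k) (X k)) = X by apply/funext => k.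
by rewrite (fix_unique iA iM iL ME LE).
Qed.

(** The mirror image of the decreasing case, except that the passage to the limit inside [sigma] now
    rests on [mean_sot]. *)
Lemma solution_increasing (Ak : 'I_n -> nat -> bop H) A :
  (forall j k, posinv_op (Ak j k)) -> (forall j, posinv_op (A j)) ->
  (forall j, increases_to (Ak j) (A j)) ->
  sot_cvg (fun k => Ms (fun j => Ak j k)) (Ms A).
Proof.
move=> iAk iA AkA; pose X k := Ms (fun j => Ak j k).
have iX k : posinv_op (X k) by case: (Ms_fix (fun j => iAk j k)).
have XE k : X k = G (fun j => Ak j k) (X k).
  by case: (Ms_fix (fun j => iAk j k)).
have X_inc k l : (k <= l)%N -> le_op (X k) (X l).
  by move=> kl; apply: solution_monotone => // j; case: (AkA j) => h _; exact: h.
have [iM ME] := Ms_fix iA.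
have AkA' j k : le_op (Ak j k) (A j).
  by case: (AkA j) => h1 h2; exact: (increasing_le h1 h2).
have XM k : le_op (X k) (Ms A) by exact: solution_monotone.
have [_ _ [c c0 [_ Mc]]] := posinv_bounds iM.
have [a a0 [_ _ [aX _]]] := posinv_bounds (iX 0%N).
have aXk k : le_op a%:Op (X k) by apply: le_op_trans aX _; exact: X_inc.
have Xkc k : le_op (X k) c%:Op by exact: le_op_trans (XM k) Mc.
have [L XL] : exists L, sot_cvg X L by exact: (increasing_cvg_le Xkc).
have iL : posinv_op L.
  apply: (posinv_le (posinv_scalar a0)).
  exact: (sot_le aXk (@sot_cst _ _ _) XL).
have [f fE] := mean_scalar hs Hinf.
have LE : L = G A L.
  apply: (sot_unique XL).
  have -> : X = (fun k => M (fun j => sigma (X k) (Ak j k))) by apply/funext.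
  apply: (mmean_continuous hM (Ak := fun j k => sigma (X k) (Ak j k))).
  - by move=> j k; exact: posinv_mean.
  - by move=> j; exact: posinv_mean.
  right=> j; split=> [k l kl|].
    apply: (mean_monotone hs); try exact: posinv_pos; first exact: X_inc.
    by case: (AkA j) => h _; exact: h.
  have [_ _ [d d0 [_ Ad]]] := posinv_bounds (iA j).
  have [b b0 [_ _ [bA _]]] := posinv_bounds (iAk j 0%N).
  have bAk k : le_op b%:Op (Ak j k).
    by apply: le_op_trans bA _; case: (AkA j) => h _; exact: h.
  have Akd k : le_op (Ak j k) d%:Op by exact: le_op_trans (AkA' j k) Ad.
  (* From [a <= X k <= c] and [b <= Ak j k <= d] come the relative bounds [b / c] and [d / a]; the
     maximum secures their order. *)
  apply: (mean_sot hs Hinf fE a0 (divr_gt0 b0 c0) c0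
    (b := Num.max (b / c) (d / a)) _ _ XL); last by case: (AkA j).
    by rewrite le_max lexx.
  move=> k; split => //.
    by apply: le_op_scalar_bounds => //; exact: ltW.
  apply: (@le_op_trans _ _ ((d / a) *: X k)).
    by apply: le_op_scalar_bounds_r => //; exact: ltW.
  by apply: le_opZl; [rewrite le_max lexx orbT|exact: posinv_pos].
by rewrite (fix_unique iA iM iL ME LE).
Qed.

Lemma solution_mean : multi_operator_mean Ms.
Proof.
have i1 : posinv_op (1 : bop H).
  by rewrite -[1]scale1r; exact: posinv_scalar.
split=> [A iA|A B iA iB AB|A S S' iA iS adj|Ak A iAk iA [|]|].
- by case: (Ms_fix iA).
- exact: solution_monotone.
- have := solution_congruence iA iS adj; rewrite -mulrA.
  rewrite -[LHS]/(bop_comp S' (bop_comp (Ms A) S)) => ->; congr Ms.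
  by apply/funext => j; rewrite -mulrA.
- exact: solution_decreasing.
- exact: solution_increasing.
have [iX XE] := Ms_fix (fun _ : 'I_n => i1).
apply: (fix_unique (fun _ : 'I_n => i1) iX i1 XE); rewrite /G.
by rewrite (mean_normalized hs) (mmean_normalized hM).
Qed.

End FixedPoints.

Theorem theorem2p1 (R : realType) (H : hilbertType R) (n : nat)
    (M : ('I_n -> bop H) -> bop H) (sigma : bop H -> bop H -> bop H)
    (Hinf : infinite_dimensional H) (n_gt0 : (0 < n)%N)
    (HM : multi_operator_mean M) (Hsigma : operator_mean sigma)
    (sigma_neql : ~ left_trivial sigma) :
  (forall A : 'I_n -> bop H, (forall j, posinv_op (A j)) ->
     exists! X0 : bop H,
       posinv_op X0 /\ X0 = M (fun j => sigma X0 (A j))) /\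
  (forall Msigma : ('I_n -> bop H) -> bop H,
     (forall A : 'I_n -> bop H, (forall j, posinv_op (A j)) ->
        posinv_op (Msigma A) /\
        Msigma A = M (fun j => sigma (Msigma A) (A j))) ->
     multi_operator_mean Msigma /\
     (forall A : 'I_n -> bop H, (forall j, posinv_op (A j)) ->
        (forall Y : bop H, posinv_op Y ->
           le_op Y (M (fun j => sigma Y (A j))) -> le_op Y (Msigma A)) /\
        (forall Y : bop H, posinv_op Y ->
           le_op (M (fun j => sigma Y (A j))) Y -> le_op (Msigma A) Y))).
Proof.
split=> [A iA|Ms Ms_fix].
  have [X iX XE] := fix_exists HM Hsigma iA.
  exists X; split=> // Y [iY YE].
  exact: (fix_unique HM Hsigma Hinf sigma_neql iA).
split; first exact: (solution_mean HM Hsigma Hinf sigma_neql Ms_fix).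
move=> A iA; have [iX XE] := Ms_fix A iA; split=> Y iY h.
  by apply: (fix_compare HM Hsigma Hinf sigma_neql iA) => //; rewrite /mean_map -XE.
by apply: (fix_compare HM Hsigma Hinf sigma_neql iA) => //; rewrite /mean_map -XE.
Qed.
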